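(* Let $E/F$ be a totally ramified cubic field extension of non-Archimedean local fields, $x=\pi_E$ a uniformizer of $E$, $n\ge0$ an integer, and $R=\mathfrak o[\pi^nx]$. For integers $s,f\ge0$ and $c\in\mathfrak o$ put $$\mathcal O^1_{s,f,c}=\mathfrak o\langle1,\ \pi^{s-\frac f3}(x+c\pi^{\frac f3-\min(n,\frac f3)}x^2),\ \pi^{\frac f3}x^2\rangle\quad\text{where }3\mid f\text{ and }0\le s-\tfrac f3\le\tfrac f3,$$ $$\mathcal O^2_{s,f,c}=\mathfrak o\langle1,\ \pi^{\frac{f+1}3}x,\ \pi^{s-\frac{f+1}3}(c\pi x+x^2)\rangle\quad\text{where }3\mid(f+1)\text{ and }0\le s-\tfrac{f+1}3<\tfrac{f+1}3.$$ Then: $\mathcal O^1_{s,f,c}$ is an overorder of $R$ if and only if $3\mid f$, $\frac32s\le f\le2s$ and $s\le\frac f3+n$; $\mathcal O^2_{s,f,c}$ is an overorder of $R$ if and only if $3\mid(f+1)$, $\frac32s+\frac12\le f\le2s$ and $f\le3n-1$. Moreover, for those $\mathcal O^i_{s,f,c}$ that are overorders of $R$: (1) $S(\mathcal O^i_{s,f,c})=s$ and $f(\mathcal O^i_{s,f,c})=f$ for $i=1,2$; (2) $\mathcal O^1_{s,f,c}=\mathcal O^1_{s',f',c'}$ if and only if $(s,f)=(s',f')$ and $c-c'\in(\pi^{\min(n,\frac f3)-(s-\frac f3)})$; and $\mathcal O^2_{s,f,c}=\mathcal O^2_{s',f',c'}$ if and only if $(s,f)=(s',f')$ and $c-c'\in(\pi^{\frac{2(f+1)}3-s-1})$;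 (3) $\mathcal O^1_{s,f,c}\ne\mathcal O^2_{s',f',c'}$; (4) $\mathcal O^i_{s,f,c}$ is Gorenstein if and only if $f=2s$, for $i=1,2$. These give an explicit classification of all overorders of $R$ (every overorder of $R$ is one of these).
   Context: $F$ has any characteristic, ring of integers $\mathfrak o$, uniformizer $\pi$. $\mathfrak o\langle u_1,u_2,u_3\rangle$ denotes the $\mathfrak o$-submodule of $E$ generated by $u_1,u_2,u_3$. An order of $E$ is a subring $\mathcal O\subset E$ containing $\mathfrak o$, finitely generated as an $\mathfrak o$-module, with $F\mathcal O=E$; an overorder of $R$ is an order containing $R$. $S(\mathcal O)$ is the $\mathfrak o$-length of $\mathcal O_E/\mathcal O$; $f(\mathcal O)\ge0$ is defined by $\{a\in\mathcal O_E:a\mathcal O_E\subset\mathcal O\}=\pi_E^{f(\mathcal O)}\mathcal O_E$. A fractional $\mathcal O$-ideal is a nonzero finitely generated $\mathcal O$-submodule $I\subset E$; it is invertible if $IJ=\mathcal O$ for some fractional ideal $J$. $\mathcal O$ is Gorenstein if every fractional $\mathcal O$-ideal $I$ with $\{y\in E:yI\subset I\}=\mathcal O$ is invertible. *)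

(* Defs.v *)
From HB Require Import structures.
From mathcomp Require Import all_boot all_order all_algebra all_field.
From mathcomp Require Import boolp classical_sets.

Set Implicit Arguments.
Unset Strict Implicit.
Unset Printing Implicit Defensive.

Import Order.TTheory GRing.Theory Num.Theory.

Local Open Scope classical_set_scope.
Local Open Scope ring_scope.

Section LocalFields.
Variables (K : fieldType) (v : K -> int).

(* v stands for a valuation K -> Z \cup {oo}: only its values on K \ {0} are
   meaningful, v 0 is arbitrary, and every use of v treats 0 separately. *)
Record discrete_valuation : Prop := {
  valuationM : forall a b, a != 0 -> b != 0 -> v (a * b) = v a + v b;
  valuationD : forall a b, a != 0 -> b != 0 -> a + b != 0 ->
    Order.min (v a) (v b) <= v (a + b);
  valuation_normalized : exists2 a, a != 0 & v a = 1
}.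

Definition val_ge (N : int) : set K := [set a | a = 0 \/ N <= v a].

Definition integers : set K := val_ge 0.

Definition uniformizer (p : K) : Prop := p != 0 /\ v p = 1.

Definition val_cauchy (u : nat -> K) : Prop :=
  forall N : int, exists m : nat, forall i j : nat,
    (m <= i)%N -> (m <= j)%N -> val_ge N (u i - u j).

Definition val_cvg (u : nat -> K) (l : K) : Prop :=
  forall N : int, exists m : nat, forall i : nat,
    (m <= i)%N -> val_ge N (u i - l).

(* The residue field is integers / val_ge 1, val_ge 1 being the maximal ideal. *)
Record nonarch_local_field : Prop := {
  local_valuation : discrete_valuation;
  local_complete : forall u, val_cauchy u -> exists l, val_cvg u l;
  local_finite_residue : exists r : seq K, forall a, integers a ->
    exists2 b, b \in r & val_ge 1 (a - b)
}.

Definition principal_ideal (p : K) : set K := [set p * a | a in integers].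

End LocalFields.

Section Modules.
Variable K : fieldType.
Implicit Types (A O I J M N : set K) (u : seq K).

Definition module_span A u : set K :=
  [set z | exists a : 'I_(size u) -> K,
     (forall i, A (a i)) /\ z = \sum_(i < size u) a i * u`_i].

Definition is_submodule A M : Prop :=
  [/\ M 0, forall y z, M y -> M z -> M (y + z)
         & forall a y, A a -> M y -> M (a * y)].

Definition submodule_chain A M N (k : nat) (C : nat -> set K) : Prop :=
  (forall i, (i <= k)%N -> [/\ is_submodule A (C i), N `<=` C i & C i `<=` M])
  /\ (forall i, (i < k)%N -> C i `<` C i.+1).

(* The A-module M / N has length k; submodules of M / N are represented by
   the submodules of M containing N. *)
Definition quotient_length A M N (k : nat) : Prop :=
  (exists C, submodule_chain A M N k C)
  /\ (forall l C, submodule_chain A M N l C -> (l <= k)%N).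

Definition fractional_ideal O I : Prop :=
  (exists u, I = module_span O u) /\ (exists2 y, I y & y != 0).

Definition ideal_mul I J : set K :=
  [set z | exists2 w : seq (K * K),
     forall p, p \in w -> I p.1 /\ J p.2 & z = \sum_(p <- w) p.1 * p.2].

Definition invertible_ideal O I : Prop :=
  exists2 J, fractional_ideal O J & ideal_mul I J = O.

Definition multiplier_ring I : set K :=
  [set y | forall z, I z -> I (y * z)].

Definition gorenstein O : Prop :=
  forall I, fractional_ideal O I -> multiplier_ring I = O ->
    invertible_ideal O I.

End Modules.

Section Orders.
Variables (F : fieldType) (vF : F -> int) (E : fieldExtType F) (vE : E -> int).
Implicit Types (O R : set E).

Definition totally_ramified : Prop :=
  forall a : F, a != 0 -> vE (a%:A) = (\dim {:E})%:Z * vF a.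

Definition base_integers : set E := [set a%:A | a in integers vF].

Definition base_span (u : seq E) : set E := module_span base_integers u.

Definition is_order O : Prop :=
  [/\ subring_closed (mem O), base_integers `<=` O,
      exists u : seq E, O = base_span u
    & forall z : E, exists2 u : seq E,
        forall y, y \in u -> O y & z \in <<u>>%VS].

Definition overorder R O : Prop := is_order O /\ R `<=` O.

Definition adjoin_integers (y : E) : set E :=
  [set z | exists2 p : {poly F},
     forall i, integers vF p`_i & z = (map_poly (in_alg E) p).[y]].

Definition order_length O (s : nat) : Prop :=
  quotient_length base_integers (integers vE) O s.

Definition order_conductor O : set E :=
  [set a | integers vE a /\ forall b, integers vE b -> O (a * b)].

(* x is a uniformizer of E. *)
Definition conductor_exponent (x : E) O (f : nat) : Prop :=
  order_conductor O = [set x ^+ f * b | b in integers vE].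

Variables (pi : F) (x : E) (n : nat).

(* The subtractions of naturals below are exact under [dom1], resp. [dom2],
   and the families are only meant for such s and f. *)
Definition dom1 (s f : nat) : bool :=
  [&& 3 %| f, f %/ 3 <= s & s - f %/ 3 <= f %/ 3]%N.

Definition order1 (s f : nat) (c : F) : set E :=
  base_span
    [:: 1;
        pi ^+ (s - f %/ 3) *:
          (x + (c * pi ^+ (f %/ 3 - minn n (f %/ 3))) *: x ^+ 2);
        pi ^+ (f %/ 3) *: x ^+ 2].

Definition dom2 (s f : nat) : bool :=
  [&& 3 %| f + 1, (f + 1) %/ 3 <= s & s - (f + 1) %/ 3 < (f + 1) %/ 3]%N.

Definition order2 (s f : nat) (c : F) : set E :=
  base_span
    [:: 1;
        pi ^+ ((f + 1) %/ 3) *: x;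
        pi ^+ (s - (f + 1) %/ 3) *: ((c * pi) *: x + x ^+ 2)].

End Orders.

(* Main.v *)
(* O_E has o-basis 1, x, x^2 and x is a root of an Eisenstein cubic, since the
   valuations of 1, x, x^2 are distinct modulo 3.  Both families consist of
   lattices L(b, a) = o<1, pi^b e1, pi^a e2> with b <= a, for an o-basis
   1, e1, e2 of O_E in which e1^2 = r + t e1 + p e2, where p is a unit in the
   first family and a uniformizer in the second.  As pi^a O_E lies in L(b, a),
   the only product to check is (pi^b e1)^2, so L(b, a) is a ring if and only
   if a <= 2b + v(p).  Conversely the Hermite normal form of an order
   containing R is of this shape; which family it belongs to is decided by
   whether the minimal valuation of the coordinates is attained at x.

   For the Gorenstein property put k = 2b + v(p) - a; then
   L(b, a) = o + pi^k o[u] with u = pi^(a - b - v(p)) e1.  If k = 0, then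
   L(b, a) = o[u] is self-dual for (y, z) |-> (coefficient of u^2 in y z), and
   the dual of an ideal I with multiplier ring o[u] is an inverse of I, by
   biduality.  If k > 0, then I = o<1, u, pi^k u^2> has multiplier ring
   L(b, a), but I^2 = o[u], and an inverse of I would force u into L(b, a). *)

Require Import Defs.
From HB Require Import structures.
From mathcomp Require Import all_boot all_order all_algebra all_field.
From mathcomp Require Import boolp classical_sets.
From mathcomp Require Import ring zify.

Set Implicit Arguments.
Unset Strict Implicit.
Unset Printing Implicit Defensive.

Import Order.TTheory GRing.Theory Num.Theory.

Local Open Scope classical_set_scope.
Local Open Scope ring_scope.

(** The numerical conditions are read off L(b, a). Its colength in O_E is a + b, so s = a + b. If a
    > 0, the largest valuation outside it is that of pi^(a-1) e2, which is 3a - 1 for e2 = x^2 and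
    3a - 2 for e2 = x. Hence f = 3a in the first family and f = 3a - 1 in the second.

    The power of pi multiplying c comes from R. In the first family pi^n x = pi^n (x + e x^2) - pi^n
    e x^2, so R lies in the lattice only if pi^n e lies in pi^a o, that is, e is divisible by pi^(a
    - min(n, a)). In the second family x is itself the last basis direction, so R only imposes a <=
    n; there e is divisible by pi because the minimal valuation is attained at x^2 alone.

    Biduality and lengths concern submodules given abstractly: ideals with arbitrary generators,
    members of an arbitrary chain. Both are controlled by choosing elements whose coordinates have
    minimal valuation, which replaces the structure theory of modules over a principal ideal
    domain. *)

(** * Discrete valuations and powers of a uniformizer *)

Section Valuation.
Variables (K : fieldType) (v : K -> int).
Hypothesis hv : discrete_valuation v.

Lemma valuation_mul a b : a != 0 -> b != 0 -> v (a * b) = v a + v b.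
Proof. exact: valuationM. Qed.

Lemma valuation_add a b : a != 0 -> b != 0 -> a + b != 0 ->
  v a <= v (a + b) \/ v b <= v (a + b).
Proof.
move=> a0 b0 ab0; apply/orP.
by have := valuationD hv a0 b0 ab0; rewrite ge_min.
Qed.

Lemma valuation1 : v 1 = 0.
Proof.
have := valuation_mul (oner_neq0 K) (oner_neq0 K).
by rewrite mulr1; move: (v 1) => w; lia.
Qed.

Lemma valuationN a : v (- a) = v a.
Proof.
have [-> |a0] := eqVneq a 0; first by rewrite oppr0.
have n1 : (-1 : K) != 0 by rewrite oppr_eq0 oner_eq0.
have h1 := valuation_mul n1 n1; rewrite mulrNN mulr1 valuation1 in h1.
by rewrite -mulN1r valuation_mul //; lia.
Qed.

Lemma valuationV a : a != 0 -> v a^-1 = - v a.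
Proof.
move=> a0; have := valuation_mul a0; move/(_ a^-1); rewrite invr_eq0 => /(_ a0).
by rewrite divff // valuation1; lia.
Qed.

Lemma valuationX a k : a != 0 -> v (a ^+ k) = k%:Z * v a.
Proof.
move=> a0; elim: k => [|k IH]; first by rewrite expr0 valuation1 mul0r.
by rewrite exprS valuation_mul ?expf_neq0 // IH intS mulrDl mul1r.
Qed.

Lemma val_geN N a : val_ge v N a -> val_ge v N (- a).
Proof. by case=> [->|h]; [left; rewrite oppr0|right; rewrite valuationN]. Qed.

Lemma val_geD N a b : val_ge v N a -> val_ge v N b -> val_ge v N (a + b).
Proof.
case=> [->|ha]; first by rewrite add0r.
case=> [->|hb]; first by rewrite addr0; right.
have [->|a0] := eqVneq a 0; first by rewrite add0r; right.
have [->|b0] := eqVneq b 0; first by rewrite addr0; right.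
have [->|ab0] := eqVneq (a + b) 0; first by left.
by right; case: (valuation_add a0 b0 ab0) => h; apply: le_trans h.
Qed.

Lemma val_geB N a b : val_ge v N a -> val_ge v N b -> val_ge v N (a - b).
Proof. by move=> ha hb; apply: val_geD => //; apply: val_geN. Qed.

Lemma val_ge_sum N (I : Type) (r : seq I) (P : pred I) (G : I -> K) :
  (forall i, P i -> val_ge v N (G i)) -> val_ge v N (\sum_(i <- r | P i) G i).
Proof.
by move=> h; elim/big_ind: _ => //; [left|exact: val_geD].
Qed.

Lemma val_geM N M a b :
  val_ge v N a -> val_ge v M b -> val_ge v (N + M) (a * b).
Proof.
case=> [->|ha]; first by rewrite mul0r; left.
case=> [->|hb]; first by rewrite mulr0; left.
have [->|a0] := eqVneq a 0; first by rewrite mul0r; left.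
have [->|b0] := eqVneq b 0; first by rewrite mulr0; left.
by right; rewrite valuation_mul //; lia.
Qed.

Lemma val_ge_le N M a : N <= M -> val_ge v M a -> val_ge v N a.
Proof. by move=> NM [->|h]; [left|right; lia]. Qed.

Lemma val_geP N a : a != 0 -> val_ge v N a <-> N <= v a.
Proof. by move=> a0; split=> [[/eqP|//]|]; [rewrite (negPf a0)|right]. Qed.

Lemma integers1 : integers v 1. Proof. by right; rewrite valuation1. Qed.

Lemma integersM a b : integers v a -> integers v b -> integers v (a * b).
Proof. exact: val_geM. Qed.

Lemma valuation_addl a b : a != 0 -> (b = 0 \/ v a < v b) ->
  a + b != 0 /\ v (a + b) = v a.
Proof.
move=> a0 [->|ab]; first by rewrite addr0.
have [-> |b0] := eqVneq b 0; first by rewrite addr0.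
have ab0 : a + b != 0.
  apply/eqP => /addr0_eq e; move: ab; rewrite -e valuationN; lia.
split=> //; have := valuation_add a0 b0 ab0.
have nb0 : - b != 0 by rewrite oppr_eq0.
have := valuation_add ab0 nb0; rewrite addrK valuationN => /(_ a0).
move: (v (a + b)) => w; lia.
Qed.

Lemma val_ge_divP N a d : d != 0 -> v d = N ->
  val_ge v N a <-> exists2 b, integers v b & a = d * b.
Proof.
move=> d0 dN; split=> [h|[b hb ->]]; last first.
  by rewrite -[N]addr0; apply: val_geM => //; right; lia.
exists (d^-1 * a); last by rewrite mulrA divff ?mul1r.
rewrite /integers -(addNr N).
by apply: val_geM => //; right; rewrite valuationV // dN.
Qed.

Lemma integers_unit_inv a : a != 0 -> v a = 0 -> integers v a^-1.
Proof. by move=> a0 h; right; rewrite valuationV // h. Qed.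

Lemma min_val (S : set K) (N : int) :
  (forall a, S a -> val_ge v N a) -> (exists2 a, S a & a != 0) ->
  exists s, [/\ S s, s != 0 & forall a, S a -> val_ge v (v s) a].
Proof.
move=> hN [a0 Sa0 na0].
(* Subtracting the lower bound [N] turns the valuations into natural numbers, where a minimum
   exists. *)
pose P k := `[< exists s, [/\ S s, s != 0 & v s = N + k%:Z] >].
have exP : exists k, P k.
  exists `|v a0 - N|%N; apply/asboolP; exists a0; split=> //.
  by case: (hN _ Sa0) => [/eqP|]; [rewrite (negPf na0)|lia].
case: (ex_minnP exP) => k /asboolP[s [Ss s0 vs]] kmin.
exists s; split=> // a Sa; have [->|a_neq0] := eqVneq a 0; first by left.
right; case: (hN _ Sa) => [/eqP|Na]; first by rewrite (negPf a_neq0).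
suff : (k <= `|v a - N|)%N by lia.
apply: kmin; apply/asboolP; exists a; split=> //; lia.
Qed.

Lemma val_ge_div N a b : b != 0 -> val_ge v (v b + N) a -> val_ge v N (a / b).
Proof.
move=> b0 h; rewrite -(_ : (v b + N) + - v b = N); last by lia.
by apply: val_geM => //; right; rewrite valuationV.
Qed.

Variable p : K.
Hypothesis hp : uniformizer v p.

Lemma unif_neq0 : p != 0. Proof. by case: hp. Qed.
Lemma unifX_neq0 k : p ^+ k != 0. Proof. by rewrite expf_neq0 // unif_neq0. Qed.

Lemma val_unifX k : v (p ^+ k) = k.
Proof. by rewrite valuationX ?unif_neq0 //; case: hp => _ ->; lia. Qed.

Lemma integers_unifX k : integers v (p ^+ k).
Proof. by right; rewrite val_unifX. Qed.

Lemma val_ge_unifX k l : (l <= k)%N -> val_ge v l (p ^+ k).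
Proof. by right; rewrite val_unifX. Qed.

Lemma val_ge_unifXP k l : val_ge v l%:Z (p ^+ k) <-> (l <= k)%N.
Proof. by rewrite val_geP ?unifX_neq0 // val_unifX; lia. Qed.

Lemma val_ge_unifP k a :
  val_ge v k%:Z a <-> exists2 b, integers v b & a = p ^+ k * b.
Proof. by apply: val_ge_divP; rewrite ?unifX_neq0 ?val_unifX. Qed.

(** An element of least valuation in the ideal [S] is a unit times a power of [p]. All exponents of
    the Hermite normal forms below arise in this way. *)
Lemma ideal_gen (S : set K) :
  (forall a, S a -> integers v a) ->
  (forall a b, integers v a -> S b -> S (a * b)) ->
  (exists2 a, S a & a != 0) ->
  exists k : nat, S (p ^+ k) /\ forall a, S a -> val_ge v k a.
Proof.
move=> Sint SM Sne; have [s [Ss s0 smin]] := min_val Sint Sne.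
have vs : 0 <= v s by case: (Sint _ Ss) => // /eqP; rewrite (negPf s0).
exists `|v s|%N; have e : `|v s|%N%:Z = v s by lia.
rewrite e; split=> //.
have -> : p ^+ `|v s| = (p ^+ `|v s| / s) * s by rewrite divfK.
by apply: SM => //; apply: val_ge_div => //; right; rewrite val_unifX e addr0.
Qed.

Lemma denominator a : exists k : nat, integers v (p ^+ k * a).
Proof.
have [->|a0] := eqVneq a 0; first by exists 0; rewrite mulr0; left.
exists `|v a|%N; right; rewrite valuation_mul ?unifX_neq0 // val_unifX; lia.
Qed.

End Valuation.

(** * Modules on three generators and their coordinates *)

Section CubicSpans.
Variables (F : fieldType) (vF : F -> int) (E : fieldExtType F).
Hypotheses (hF : discrete_valuation vF) (hdeg : \dim {:E} = 3%N).
Variable pi : F.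
Hypothesis hpi : uniformizer vF pi.
Local Notation o := (integers vF).
Local Notation "⟨ a , b , c ⟩" := (base_span vF [:: a; b; c]).
Implicit Types (M N : set E) (y z e : E) (a b c : F).

(** Here o acts through [*:], whereas [is_submodule] lets the image of o in [E] act by
    multiplication. *)
Definition osubmodule M : Prop :=
  [/\ M 0, forall y z, M y -> M z -> M (y + z)
         & forall a y, o a -> M y -> M (a *: y)].

Lemma osubmoduleP M : is_submodule (@base_integers _ vF E) M <-> osubmodule M.
Proof.
split=> -[M0 MD MZ]; split=> // a y.
  by move=> oa My; rewrite -mulr_algl; apply: MZ => //; exists a.
by move=> [b ob <-] My; rewrite mulr_algl; apply: MZ.
Qed.

Lemma osubmoduleN M z : osubmodule M -> M z -> M (- z).
Proof.
move=> [_ _ MZ] Mz; rewrite -scaleN1r; apply: MZ => //.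
by apply: (val_geN hF); exact: (integers1 hF).
Qed.

Lemma osubmoduleB M y z : osubmodule M -> M y -> M z -> M (y - z).
Proof. by move=> sM My Mz; case: (sM) => _ + _; apply=> //; exact: osubmoduleN. Qed.

Lemma osubmodule_comb M a b c y0 y1 y2 : osubmodule M -> o a -> o b -> o c ->
  M y0 -> M y1 -> M y2 -> M (a *: y0 + b *: y1 + c *: y2).
Proof. by move=> [_ MD MZ] *; apply: (MD); [apply: MD|]; apply: MZ. Qed.

Lemma module_span3P (A : set E) e0 e1 e2 z :
  module_span A [:: e0; e1; e2] z <->
  exists a b c : E, [/\ A a, A b, A c & z = a * e0 + b * e1 + c * e2].
Proof.
split=> [[a [Aa ->]]|[a [b [c [Aa Ab Ac ->]]]]].
  exists (a ord0), (a (lift ord0 ord0)), (a (lift ord0 (lift ord0 ord0))).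
  by split=> //; rewrite !big_ord_recl big_ord0 addr0 addrA.
exists (fun i : 'I_3 => nth 0 [:: a; b; c] i); split.
  by case=> [[|[|[]]]].
by rewrite !big_ord_recl big_ord0 addr0 addrA.
Qed.

Lemma span3P e0 e1 e2 z : ⟨e0, e1, e2⟩ z <->
  exists a b c, [/\ o a, o b, o c & z = a *: e0 + b *: e1 + c *: e2].
Proof.
rewrite /base_span module_span3P; split.
  move=> [_ [_ [_ [[a oa <-] [b ob <-] [c oc <-] ->]]]].
  by exists a, b, c; rewrite !mulr_algl.
move=> [a [b [c [oa ob oc ->]]]]; exists a%:A, b%:A, c%:A.
by rewrite !mulr_algl; split=> //; [exists a|exists b|exists c].
Qed.

Lemma span3_submodule e0 e1 e2 : osubmodule ⟨e0, e1, e2⟩.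
Proof.
split=> [|y z|a y oa].
- by apply/span3P; exists 0, 0, 0; rewrite !scale0r !addr0; split=> //; left.
- move=> /span3P[a [b [c [oa ob oc ->]]]] /span3P[a' [b' [c' [oa' ob' oc' ->]]]].
  apply/span3P; exists (a + a'), (b + b'), (c + c').
  split; try exact: (val_geD hF).
  by rewrite addrACA (addrACA (a *: e0)) -!scalerDl.
- move=> /span3P[b [c [d [ob oc od ->]]]]; apply/span3P.
  exists (a * b), (a * c), (a * d); rewrite !scalerDr !scalerA.
  by split=> //; apply: integersM.
Qed.

Lemma span3_gens e0 e1 e2 :
  [/\ ⟨e0, e1, e2⟩ e0, ⟨e0, e1, e2⟩ e1 & ⟨e0, e1, e2⟩ e2].
Proof.
have o1 := integers1 hF; have o0 : o 0 by left.
split; apply/span3P; [exists 1, 0, 0|exists 0, 1, 0|exists 0, 0, 1];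
  by rewrite !scale0r !scale1r ?addr0 ?add0r.
Qed.

Lemma span3_sub M e0 e1 e2 : osubmodule M -> M e0 -> M e1 -> M e2 ->
  ⟨e0, e1, e2⟩ `<=` M.
Proof.
by move=> sM *; move=> z /span3P[a [b [c [oa ob oc ->]]]]; exact: osubmodule_comb.
Qed.

(** For an o-submodule this is the condition F M = E. *)
Definition full M : Prop := forall z, exists2 c : F, c != 0 & M (c *: z).

Definition cubic_basis (e0 e1 e2 : E) : Prop := basis_of {:E} [:: e0; e1; e2].

Definition crd0 e0 e1 e2 z : F := coord [tuple e0; e1; e2] ord0 z.
Definition crd1 e0 e1 e2 z : F := coord [tuple e0; e1; e2] (lift ord0 ord0) z.
Definition crd2 e0 e1 e2 z : F :=
  coord [tuple e0; e1; e2] (lift ord0 (lift ord0 ord0)) z.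

Definition linear_form (l : E -> F) : Prop :=
  forall a y z, l (a *: y + z) = a * l y + l z.

Section LinearForm.
Variable l : E -> F.
Hypothesis hl : linear_form l.

Lemma linform0 : l 0 = 0.
Proof.
have := hl 1 0 0; rewrite scaler0 addr0 mul1r => /(congr1 (fun t => t - l 0)).
by rewrite subrr addrK.
Qed.

Lemma linformZ a y : l (a *: y) = a * l y.
Proof. by have := hl a y 0; rewrite !addr0 linform0 addr0. Qed.

Lemma linformD y z : l (y + z) = l y + l z.
Proof. by have := hl 1 y z; rewrite scale1r mul1r. Qed.

Lemma linformB y z : l (y - z) = l y - l z.
Proof. by rewrite linformD -scaleN1r linformZ mulN1r. Qed.

Lemma linform_comb a b c y0 y1 y2 :
  l (a *: y0 + b *: y1 + c *: y2) = a * l y0 + b * l y1 + c * l y2.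
Proof. by rewrite !linformD !linformZ. Qed.

End LinearForm.

Lemma crd_linear e0 e1 e2 :
  [/\ linear_form (crd0 e0 e1 e2), linear_form (crd1 e0 e1 e2)
    & linear_form (crd2 e0 e1 e2)].
Proof. by split=> a y z; rewrite /crd0 /crd1 /crd2 linearP. Qed.

Section Coordinates.
Variables e0 e1 e2 : E.
Hypothesis he : cubic_basis e0 e1 e2.
Local Notation c0 := (crd0 e0 e1 e2).
Local Notation c1 := (crd1 e0 e1 e2).
Local Notation c2 := (crd2 e0 e1 e2).

Lemma crdE z : z = c0 z *: e0 + c1 z *: e1 + c2 z *: e2.
Proof.
have := @coord_basis _ _ _ _ [tuple e0; e1; e2] z he (memvf z).
by rewrite !big_ord_recl big_ord0 addr0 addrA.
Qed.

Lemma crd_gens : [/\ c0 e0 = 1, c0 e1 = 0 & c0 e2 = 0] /\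
  [/\ c1 e0 = 0, c1 e1 = 1 & c1 e2 = 0] /\
  [/\ c2 e0 = 0, c2 e1 = 0 & c2 e2 = 1].
Proof.
have fX : free [tuple e0; e1; e2] by exact: basis_free he.
have h i j := @coord_free _ _ _ [tuple e0; e1; e2] i j fX.
split; last split; split.
- exact: (h ord0 ord0).
- exact: (h (lift ord0 ord0) ord0).
- exact: (h (lift ord0 (lift ord0 ord0)) ord0).
- exact: (h ord0 (lift ord0 ord0)).
- exact: (h (lift ord0 ord0) (lift ord0 ord0)).
- exact: (h (lift ord0 (lift ord0 ord0)) (lift ord0 ord0)).
- exact: (h ord0 (lift ord0 (lift ord0 ord0))).
- exact: (h (lift ord0 ord0) (lift ord0 (lift ord0 ord0))).
- exact: (h (lift ord0 (lift ord0 ord0)) (lift ord0 (lift ord0 ord0))).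
Qed.

Lemma crd_comb a b c :
  [/\ c0 (a *: e0 + b *: e1 + c *: e2) = a,
      c1 (a *: e0 + b *: e1 + c *: e2) = b
    & c2 (a *: e0 + b *: e1 + c *: e2) = c].
Proof.
have [l0 l1 l2] := crd_linear e0 e1 e2.
rewrite !linform_comb //.
have [[g00 g01 g02] [[g10 g11 g12] [g20 g21 g22]]] := crd_gens.
rewrite g00 g01 g02 g10 g11 g12 g20 g21 g22.
by rewrite !mulr1 !mulr0 !addr0 !add0r.
Qed.

Lemma span3_scaledP i j z : ⟨e0, pi ^+ i *: e1, pi ^+ j *: e2⟩ z <->
  [/\ o (c0 z), val_ge vF i (c1 z) & val_ge vF j (c2 z)].
Proof.
rewrite span3P; split.
  move=> [a [b [c [oa ob oc ->]]]]; rewrite !scalerA.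
  have [-> -> ->] := crd_comb a (b * pi ^+ i) (c * pi ^+ j).
  by split=> //; apply/(val_ge_unifP hF hpi); [exists b|exists c] => //; rewrite mulrC.
move=> [z0 /(val_ge_unifP hF hpi)[b ob eb] /(val_ge_unifP hF hpi)[c oc ec]].
exists (c0 z), b, c; split=> //.
by rewrite {1}[z]crdE eb ec !scalerA ![pi ^+ _ * _]mulrC.
Qed.

Lemma span3_coordP z : ⟨e0, e1, e2⟩ z <-> [/\ o (c0 z), o (c1 z) & o (c2 z)].
Proof. by have := span3_scaledP 0 0 z; rewrite !scale1r. Qed.

Lemma basis_full : full ⟨e0, e1, e2⟩.
Proof.
move=> z; have [l0 l1 l2] := crd_linear e0 e1 e2.
have [i hi] := denominator hF hpi (c0 z); have [j hj] := denominator hF hpi (c1 z).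
have [k hk] := denominator hF hpi (c2 z).
exists (pi ^+ (i + j + k)); first exact: (unifX_neq0 hpi).
have ox := integers_unifX hF hpi.
apply/span3_coordP; rewrite !linformZ //; split.
- have -> : pi ^+ (i + j + k) * c0 z = pi ^+ (j + k) * (pi ^+ i * c0 z).
    by rewrite !exprD; ring.
  exact: integersM.
- have -> : pi ^+ (i + j + k) * c1 z = pi ^+ (i + k) * (pi ^+ j * c1 z).
    by rewrite !exprD; ring.
  exact: integersM.
- have -> : pi ^+ (i + j + k) * c2 z = pi ^+ (i + j) * (pi ^+ k * c2 z).
    by rewrite !exprD; ring.
  exact: integersM.
Qed.

End Coordinates.

(** Three generators of a full module span [E], and a spanning family of size \dim E is free. *)
Lemma full_basis e0 e1 e2 : full ⟨e0, e1, e2⟩ -> cubic_basis e0 e1 e2.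
Proof.
move=> fX; rewrite /cubic_basis basisEdim hdeg leqnn andbT.
apply/subvP => z _; have [c c0 /span3P[a [b [d [_ _ _ e]]]]] := fX z.
rewrite -[z](scalerK c0) e; apply: memvZ.
by rewrite !memvD // memvZ // memv_span // !inE eqxx ?orbT.
Qed.

Lemma full_subset M N : M `<=` N -> full M -> full N.
Proof. by move=> MN fM z; have [c c0 /MN] := fM z; exists c. Qed.

End CubicSpans.

(** * Sums of terms with distinct valuations *)

Section IndependentValuations.
Variables (K : fieldType) (v : K -> int).
Hypothesis hv : discrete_valuation v.

Lemma val_ge_split N a b : a = 0 \/ b = 0 \/ v a != v b ->
  val_ge v N (a + b) -> val_ge v N a /\ val_ge v N b.
Proof.
have [-> _|a0] := eqVneq a 0; first by rewrite add0r; split=> //; left.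
have [-> _|b0] := eqVneq b 0; first by rewrite addr0; split=> //; left.
case=> [/eqP|[/eqP|vab]]; [by rewrite (negPf a0)|by rewrite (negPf b0)|].
have [lab|lba] : v a < v b \/ v b < v a by lia.
  have [ab0 e] := valuation_addl hv a0 (or_intror lab).
  by rewrite val_geP // e => h; split; right; lia.
have [ab0 e] := valuation_addl hv b0 (or_intror lba).
by rewrite addrC val_geP // e => h; split; right; lia.
Qed.

(** When the valuations differ, the valuation of the sum is one of the two, so any property shared
    by both passes to it. *)
Lemma val_add_neq (P : int -> Prop) a b :
  (a = 0 \/ P (v a)) -> (b = 0 \/ P (v b)) -> (a = 0 \/ b = 0 \/ v a != v b) ->
  a + b = 0 \/ P (v (a + b)).
Proof.
move=> ha hb hab; have [->|a0] := eqVneq a 0; first by rewrite add0r.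
have [->|b0] := eqVneq b 0; first by rewrite addr0.
case: ha => [/eqP|Pa]; first by rewrite (negPf a0).
case: hb => [/eqP|Pb]; first by rewrite (negPf b0).
case: hab => [/eqP|[/eqP|vab]]; [by rewrite (negPf a0)|by rewrite (negPf b0)|].
have [lab|lba] : v a < v b \/ v b < v a by lia.
  by have [_ ->] := valuation_addl hv a0 (or_intror lab); right.
by rewrite addrC; have [_ ->] := valuation_addl hv b0 (or_intror lba); right.
Qed.

Lemma val_ge_split3 N t0 t1 t2 :
  (t0 = 0 \/ (3 %| v t0)%Z) -> (t1 = 0 \/ (3 %| v t1 - 1)%Z) ->
  (t2 = 0 \/ (3 %| v t2 - 2)%Z) ->
  val_ge v N (t0 + t1 + t2) -> [/\ val_ge v N t0, val_ge v N t1 & val_ge v N t2].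
Proof.
move=> h0 h1 h2 h.
have h01 : t0 = 0 \/ t1 = 0 \/ v t0 != v t1.
  case: h0 h1 => [?|h0] [?|h1]; auto; right; right; lia.
have h012 : t0 + t1 = 0 \/ t2 = 0 \/ v (t0 + t1) != v t2.
  case: h2 => [?|h2]; [by right; left|].
  (* The property passed to [t0 + t1] is that its valuation differs from [v t2]; each summand has it
     by its residue modulo 3. *)
  have [] := @val_add_neq (fun w => w != v t2) t0 t1 _ _ h01; [| |by left|].
  - by case: h0 => [?|h0]; [left|right; lia].
  - by case: h1 => [?|h1]; [left|right; lia].
  - by right; right.
have [/(val_ge_split h01)[? ?] ?] := val_ge_split h012 h.
by split.
Qed.

Lemma val_ge_all a : (forall N, val_ge v N a) -> a = 0.
Proof. by case/(_ (v a + 1)) => //; lia. Qed.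

End IndependentValuations.

(** * The integers of a totally ramified cubic extension *)

Section TotallyRamifiedCubic.
Variables (F : fieldType) (vF : F -> int) (E : fieldExtType F) (vE : E -> int).
Hypotheses (hF : discrete_valuation vF) (hE : discrete_valuation vE).
Hypotheses (hdeg : \dim {:E} = 3%N) (hram : totally_ramified vF vE).
Variables (pi : F) (x : E).
Hypotheses (hpi : uniformizer vF pi) (hx : uniformizer vE x).
Local Notation o := (integers vF).
Local Notation "⟨ a , b , c ⟩" := (base_span vF [:: a; b; c]).

Lemma val_scalar a : a != 0 -> vE a%:A = 3 * vF a.
Proof. by move=> a0; rewrite hram // hdeg. Qed.

Lemma scalar_neq0 (a : F) : a != 0 -> (a%:A : E) != 0.
Proof. by move=> a0; rewrite scaler_eq0 negb_or a0 oner_eq0. Qed.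

Lemma val_scale a (y : E) : a != 0 -> y != 0 -> vE (a *: y) = 3 * vF a + vE y.
Proof.
by move=> a0 y0; rewrite -mulr_algl (valuation_mul hE) ?val_scalar // scalar_neq0.
Qed.

Lemma val_ge_scale N M a (y : E) : val_ge vF N a -> val_ge vE M y ->
  val_ge vE (3 * N + M) (a *: y).
Proof.
move=> [->|ha]; first by rewrite scale0r; left.
move=> [->|hy]; first by rewrite scaler0; left.
have [->|a0] := eqVneq a 0; first by rewrite scale0r; left.
have [->|y0] := eqVneq y 0; first by rewrite scaler0; left.
by right; rewrite val_scale //; lia.
Qed.

Lemma val_ge_scale_unif (N : int) k (y : E) :
  val_ge vE (3 * k%:Z + N) (pi ^+ k *: y) <-> val_ge vE N y.
Proof.
have [->|y0] := eqVneq y 0; first by rewrite scaler0; split; left.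
rewrite !val_geP ?scaler_eq0 ?negb_or ?y0 ?(unifX_neq0 hpi) //.
rewrite val_scale ?(unifX_neq0 hpi) // (val_unifX hF hpi); lia.
Qed.

Lemma val_ge_power_basis N a b c :
  val_ge vE N (a%:A + b *: x + c *: x ^+ 2) <->
  [/\ val_ge vE N (a%:A), val_ge vE N (b *: x) & val_ge vE N (c *: x ^+ 2)].
Proof.
have [x0 vx] := hx; split=> [|[*]]; last by do 2?apply: (val_geD hE).
apply: (val_ge_split3 hE).
- have [->|a0] := eqVneq a 0; first by left; rewrite scale0r.
  by right; rewrite val_scalar //; lia.
- have [->|b0] := eqVneq b 0; first by left; rewrite scale0r.
  by right; rewrite val_scale // vx; lia.
- have [->|c0] := eqVneq c 0; first by left; rewrite scale0r.
  by right; rewrite val_scale ?expf_neq0 // (valuationX hE) // vx; lia.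
Qed.

Lemma val_ge_scaleXP N a (i : nat) :
  val_ge vE N (a *: x ^+ i) <-> (a = 0 \/ N <= 3 * vF a + i%:Z).
Proof.
have [x0 vx] := hx.
have [->|a0] := eqVneq a 0; first by rewrite scale0r; split; left.
have xi0 : x ^+ i != 0 by rewrite expf_neq0.
rewrite val_geP ?scaler_eq0 ?negb_or ?a0 // val_scale //.
rewrite (valuationX hE) // vx; split=> [h|[/eqP|h]]; [right|by rewrite (negPf a0)|]; lia.
Qed.

Lemma power_basis : cubic_basis 1 x (x ^+ 2).
Proof.
rewrite /cubic_basis basisEfree subvf hdeg !andbT.
apply/(@freeP _ _ _ [tuple 1; x; x ^+ 2]) => k.
rewrite !big_ord_recl big_ord0 addr0 addrA /= => e.
have h N : [/\ val_ge vE N ((k ord0)%:A), val_ge vE N (k (lift ord0 ord0) *: x)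
    & val_ge vE N (k (lift ord0 (lift ord0 ord0)) *: x ^+ 2)].
  by apply/val_ge_power_basis; rewrite e; left.
have [x0 _] := hx; have x20 : x ^+ 2 != 0 by rewrite expf_neq0.
have k0 : k ord0 = 0.
  have /eqP : (k ord0)%:A = 0 :> E by apply: (@val_ge_all _ vE) => N; case: (h N).
  by rewrite scaler_eq0 oner_eq0 orbF => /eqP.
have k1 : k (lift ord0 ord0) = 0.
  have /eqP : k (lift ord0 ord0) *: x = 0 by apply: (@val_ge_all _ vE) => N; case: (h N).
  by rewrite scaler_eq0 (negPf x0) orbF => /eqP.
have k2 : k (lift ord0 (lift ord0 ord0)) = 0.
  have /eqP : k (lift ord0 (lift ord0 ord0)) *: x ^+ 2 = 0.
    by apply: (@val_ge_all _ vE) => N; case: (h N).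
  by rewrite scaler_eq0 (negPf x20) orbF => /eqP.
by case=> [[|[|[|//]]]] hi; [rewrite -k0|rewrite -k1|rewrite -k2];
  congr k; apply: val_inj.
Qed.

Lemma integers_power_basis : integers vE = ⟨1, x, x ^+ 2⟩.
Proof.
have pb := power_basis; apply/seteqP; split=> z.
  rewrite {1}[z](crdE pb) => /val_ge_power_basis [h0 h1 h2].
  apply/(span3_coordP hF hpi pb).
  move: ((val_ge_scaleXP 0 _ 0).1 h0) ((val_ge_scaleXP 0 _ 1).1 h1) => {}h0 {}h1.
  have {}h2 := (val_ge_scaleXP 0 _ 2).1 h2.
  split; rewrite /integers /val_ge /=.
  - by case: h0 => h0; [left|right; lia].
  - by case: h1 => h1; [left|right; lia].
  - by case: h2 => h2; [left|right; lia].
move=> /span3P[a [b [c [oa ob oc ->]]]]; have [x0 vx] := hx.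
have int_scale d (i : nat) : o d -> integers vE (d *: x ^+ i).
  move=> od; apply/val_ge_scaleXP; case: od => [->|od]; [by left|by right; lia].
apply/val_ge_power_basis; split; [exact: (int_scale a 0)|exact: (int_scale b 1)|].
exact: (int_scale c 2).
Qed.

(** Everything follows from v(x^3) = 3 read in coordinates: the terms have valuations 3 v(ga), 3
    v(be) + 1 and 3 v(al) + 2, and their minimum is 3. *)
Lemma eisenstein : exists al be ga : F,
  [/\ x ^+ 3 = ga%:A + be *: x + al *: x ^+ 2,
      val_ge vF 1 al, val_ge vF 1 be, ga != 0 & vF ga = 1].
Proof.
have pb := power_basis; have [x0 vx] := hx.
set al := crd2 1 x (x ^+ 2) (x ^+ 3); set be := crd1 1 x (x ^+ 2) (x ^+ 3).
set ga := crd0 1 x (x ^+ 2) (x ^+ 3).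
have e : x ^+ 3 = ga%:A + be *: x + al *: x ^+ 2 by exact: (crdE pb).
have vx3 : vE (x ^+ 3) = 3 by rewrite (valuationX hE) // vx.
have x30 : x ^+ 3 != 0 by rewrite expf_neq0.
have h N : N <= 3 <-> [/\ ga = 0 \/ N <= 3 * vF ga + 0%:Z,
    be = 0 \/ N <= 3 * vF be + 1%:Z & al = 0 \/ N <= 3 * vF al + 2%:Z].
  have -> : (N <= 3) = (N <= vE (x ^+ 3)) by rewrite vx3.
  rewrite -(val_geP vE N x30) e val_ge_power_basis.
  by split=> -[h0 h1 h2]; split; by [
    apply/(val_ge_scaleXP N ga 0)|apply/(val_ge_scaleXP N be 1)
   |apply/(val_ge_scaleXP N al 2)].
have [h0 h1 h2] := (h 3).1 (lexx _).
exists al, be, ga; rewrite -e.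
have a1 : val_ge vF 1 al by case: h2 => ?; [left|right; lia].
have b1 : val_ge vF 1 be by case: h1 => ?; [left|right; lia].
(* The terms in x and x^2 already have valuation at least 4 and 5, so only the constant term can
   account for the valuation being exactly 3. *)
have nh : ~ (ga = 0 \/ 4 <= 3 * vF ga + 0%:Z).
  move=> hga; suff : (4 : int) <= 3 by [].
  by apply/h; split=> //; [case: b1|case: a1] => h'; (try by left); right; lia.
have [ga0|ga0] := eqVneq ga 0; first by case: nh; left.
split=> //; case: h0 => [/eqP|h0]; first by rewrite (negPf ga0).
have : ~ (4 <= 3 * vF ga + 0%:Z) by move=> h'; apply: nh; right.
lia.
Qed.

End TotallyRamifiedCubic.

(** * Lattices, ideals and their products *)

Section Lattices.
Variables (F : fieldType) (vF : F -> int) (E : fieldExtType F).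
Hypotheses (hF : discrete_valuation vF) (hdeg : \dim {:E} = 3%N).
Variable pi : F.
Hypothesis hpi : uniformizer vF pi.
Local Notation o := (integers vF).
Local Notation "⟨ a , b , c ⟩" := (base_span vF [:: a; b; c]).
Implicit Types (M N I J : set E) (y z : E) (a b c : F).

(** [m] is chosen so that [l m] has least valuation in the image of [M]; the bounded denominator [c]
    makes this minimum exist. Consequently [M] is the sum of o m and the kernel of [l] on [M]. *)
Lemma submodule_split M (l : E -> F) :
  (exists2 c, c != 0 & forall z, M z -> o (c * l z)) ->
  (exists2 z, M z & l z != 0) ->
  exists m, [/\ M m, l m != 0 & forall z, M z -> o (l z / l m)].
Proof.
move=> [c c0 hc] [z0 Mz0 lz0].
have [||s [[m Mm <-] s0 smin]] := @min_val _ vF [set l z | z in M] (- vF c).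
- move=> _ [z Mz <-]; rewrite -(mulfK c0 (l z)); apply: (val_ge_div hF c0).
  by rewrite subrr mulrC; apply: hc.
- by exists (l z0) => //; exists z0.
exists m; split=> // z Mz; apply: (val_ge_div hF s0); rewrite addr0.
by apply: smin; exists z.
Qed.

Definition commensurable_in M N : Prop :=
  exists2 c : F, c != 0 & forall z, M z -> N (c *: z).

(** Splitting off one coordinate at a time gives a triangular basis: [m2] handles the last
    coordinate, [m1] the middle one on elements whose last coordinate vanishes, and [m0] what
    remains. It supplies bases for ideals and duals, which are not presented by three generators. *)
Lemma lattice_basis M e0 e1 e2 : cubic_basis e0 e1 e2 -> osubmodule vF M ->
  full M -> commensurable_in M ⟨e0, e1, e2⟩ ->
  exists m0 m1 m2, cubic_basis m0 m1 m2 /\ M = ⟨m0, m1, m2⟩.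
Proof.
move=> he sM fM [c c0 hc].
have [l0 l1 l2] := crd_linear e0 e1 e2.
have [[g00 g01 g02] [[g10 g11 g12] [g20 g21 g22]]] := crd_gens he.
have hM z : M z -> [/\ o (c * crd0 e0 e1 e2 z), o (c * crd1 e0 e1 e2 z)
    & o (c * crd2 e0 e1 e2 z)].
  by move/hc => /(span3_coordP hF hpi he); rewrite !linformZ.
have [||m2 [Mm2 n2 h2]] := @submodule_split M (crd2 e0 e1 e2).
- by exists c => // z /hM[].
- by have [d d0 Md] := fM e2; exists (d *: e2); rewrite // linformZ // g22 mulr1.
pose M1 := [set z | M z /\ crd2 e0 e1 e2 z = 0].
have [||m1 [[Mm1 e21] n1 h1]] := @submodule_split M1 (crd1 e0 e1 e2).
- by exists c => // z [/hM[]].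
- have [d d0 Md] := fM e1; exists (d *: e1); last by rewrite linformZ // g11 mulr1.
  by split; rewrite // linformZ // g21 mulr0.
pose M0 := [set z | [/\ M z, crd2 e0 e1 e2 z = 0 & crd1 e0 e1 e2 z = 0]].
have [||m0 [[Mm0 e20 e10] n0 h0]] := @submodule_split M0 (crd0 e0 e1 e2).
- by exists c => // z [/hM[]].
- have [d d0 Md] := fM e0; exists (d *: e0); last by rewrite linformZ // g00 mulr1.
  by split; rewrite // linformZ // ?g20 ?g10 mulr0.
have sub : M `<=` ⟨m0, m1, m2⟩.
  move=> z Mz; have [_ MD MZ] := sM.
  set b2 := crd2 e0 e1 e2 z / crd2 e0 e1 e2 m2.
  have ob2 : o b2 by exact: h2.
  have Mz1 : M1 (z - b2 *: m2).
    split; first by apply: (osubmoduleB hF) => //; apply: MZ.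
    by rewrite linformB // linformZ // /b2 divfK // subrr.
  set b1 := crd1 e0 e1 e2 (z - b2 *: m2) / crd1 e0 e1 e2 m1.
  have ob1 : o b1 by exact: h1.
  have Mz0 : M0 (z - b2 *: m2 - b1 *: m1).
    case: Mz1 => ? e; split; first by apply: (osubmoduleB hF) => //; apply: MZ.
      by rewrite linformB // linformZ // e e21 mulr0 subrr.
    by rewrite linformB // linformZ // /b1 divfK // subrr.
  set b0 := crd0 e0 e1 e2 (z - b2 *: m2 - b1 *: m1) / crd0 e0 e1 e2 m0.
  have ob0 : o b0 by exact: h0.
  apply/span3P; exists b0, b1, b2; split=> //.
  suff e : z - b2 *: m2 - b1 *: m1 = b0 *: m0 by rewrite -e !subrK.
  case: Mz0 => _ e2' e1'.
  rewrite [LHS](crdE he) [RHS](crdE he) e1' e2' !linformZ //.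
  by rewrite /b0 divfK // e10 e20 !mulr0.
exists m0, m1, m2; split; last first.
  by apply/seteqP; split=> //; apply: span3_sub.
by apply: (full_basis hdeg (vF := vF)); exact: full_subset fM.
Qed.

Lemma full_integral M z : osubmodule vF M -> full M ->
  exists c : F, [/\ c != 0, o c & M (c *: z)].
Proof.
move=> [_ _ MZ] fM; have [c c0 Mc] := fM z.
have [k ok] := denominator hF hpi c.
exists (pi ^+ k * c); split=> //; first by rewrite mulf_neq0 ?(unifX_neq0 hpi).
by rewrite -scalerA; apply: MZ => //; exact: (integers_unifX hF hpi).
Qed.

Section OrderModules.
Variable O : set E.
Hypotheses (sO : osubmodule vF O) (O1 : O 1) (fO : full O).
Hypothesis OM : forall y z, O y -> O z -> O (y * z).

Lemma order_scalar a : o a -> O a%:A.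
Proof. by case: sO => _ _ + oa; apply. Qed.

Lemma module_span_stable (w : seq E) y z :
  O y -> module_span O w z -> module_span O w (y * z).
Proof.
move=> Oy [a [Oa ->]]; exists (fun i => y * a i); split=> [i|]; first exact: OM.
by rewrite mulr_sumr; apply: eq_bigr => i _; rewrite mulrA.
Qed.

Lemma module_span_submodule (w : seq E) : osubmodule vF (module_span O w).
Proof.
have [O0 OD OZ] := sO; split=> [|y z [a [Oa ->]] [b [Ob ->]]|a y oa].
- exists (fun=> 0); split=> //; rewrite big1 // => i _; exact: mul0r.
- exists (fun i => a i + b i); split=> [i|]; first exact: OD.
  by rewrite -big_split; apply: eq_bigr => i _; rewrite mulrDl.
- by rewrite -mulr_algl => h; apply: module_span_stable => //; exact: order_scalar.
Qed.

Lemma module_span_commensurable (w : seq E) :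
  commensurable_in (module_span O w) O.
Proof.
have [O0 OD OZ] := sO.
have [c c0 hc] : exists2 c : F, c != 0 & forall y, y \in w -> O (c *: y).
  elim: w => [|y w [c c0 hc]]; first by exists 1; rewrite ?oner_eq0.
  have [d [d0 od hd]] := full_integral (c *: y) sO fO.
  exists (d * c) => [|z]; first by rewrite mulf_neq0.
  by rewrite inE -scalerA => /predU1P[->//|zw]; apply: OZ => //; exact: hc.
exists c => // z [a [Oa ->]]; rewrite scaler_sumr.
elim/big_ind: _ => // i _; rewrite scalerAr; apply: OM => //.
by apply: hc; apply: mem_nth.
Qed.

(** Since o lies in [O], an o-basis of an [O]-stable lattice also generates it over [O]; this is how
    lattices are recognised as fractional ideals. *)
Lemma span3_module_span I m0 m1 m2 : I = ⟨m0, m1, m2⟩ ->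
  (forall y z, O y -> I z -> I (y * z)) -> I = module_span O [:: m0; m1; m2].
Proof.
move=> eI st; have sI := span3_submodule hF m0 m1 m2.
have [h0 h1 h2] := span3_gens hF m0 m1 m2.
apply/seteqP; split=> z.
  rewrite eI => /span3P[a [b [c [oa ob oc ->]]]]; apply/module_span3P.
  by exists a%:A, b%:A, c%:A; rewrite !mulr_algl; split=> //; exact: order_scalar.
move/module_span3P => [a [b [c [Oa Ob Oc ->]]]].
have h e d : O e -> ⟨m0, m1, m2⟩ d -> I (e * d) by rewrite -eI; exact: st.
move: (h _ _ Oa h0) (h _ _ Ob h1) (h _ _ Oc h2); rewrite eI => k0 k1 k2.
by case: sI => _ D _; apply: (D) => //; apply: D.
Qed.

Lemma stable_full I y0 : osubmodule vF I -> I y0 -> y0 != 0 ->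
  (forall y z, O y -> I z -> I (y * z)) -> full I.
Proof.
move=> sI Iy0 n0 st z; have [c c0 Oc] := fO (z / y0); exists c => //.
by have := st _ _ Oc Iy0; rewrite -scalerAl divfK.
Qed.

End OrderModules.

Lemma ideal_mul_submodule I J : osubmodule vF I -> osubmodule vF (ideal_mul I J).
Proof.
move=> [I0 ID IZ]; split.
- by exists [::] => //; rewrite big_nil.
- move=> y z [s hs ->] [t ht ->]; exists (s ++ t); last by rewrite big_cat.
  by move=> p; rewrite mem_cat => /orP[/hs|/ht].
- move=> a y oa [s hs ->]; exists [seq (a *: p.1, p.2) | p <- s].
    by move=> p /mapP[q /hs[? ?] ->]; split=> //=; apply: IZ.
  by rewrite big_map scaler_sumr; apply: eq_bigr => p _ /=; rewrite scalerAl.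
Qed.

Lemma ideal_mul_prod I J y z : I y -> J z -> ideal_mul I J (y * z).
Proof.
move=> Iy Jz; exists [:: (y, z)]; last by rewrite big_seq1.
by move=> p; rewrite inE => /eqP ->.
Qed.

Lemma ideal_mul_sub I J M : osubmodule vF M ->
  (forall y z, I y -> J z -> M (y * z)) -> ideal_mul I J `<=` M.
Proof.
move=> [M0 MD _] h _ [s hs ->]; rewrite big_seq; elim/big_ind: _ => // p /hs[].
exact: h.
Qed.

Lemma span3_mul M e0 e1 e2 d0 d1 d2 : osubmodule vF M ->
  M (e0 * d0) -> M (e0 * d1) -> M (e0 * d2) ->
  M (e1 * d0) -> M (e1 * d1) -> M (e1 * d2) ->
  M (e2 * d0) -> M (e2 * d1) -> M (e2 * d2) ->
  forall y z, ⟨e0, e1, e2⟩ y -> ⟨d0, d1, d2⟩ z -> M (y * z).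
Proof.
move=> [M0 MD MZ] h00 h01 h02 h10 h11 h12 h20 h21 h22.
have sM y : osubmodule vF [set z | M (y * z)].
  split=> [|z z' hz hz'|a z oa hz] /=; rewrite ?mulr0 // ?mulrDr -?scalerAr.
    exact: MD.
  exact: MZ.
have sM' z : osubmodule vF [set y | M (y * z)].
  split=> [|y y' hy hy'|a y oa hy] /=; rewrite ?mul0r // ?mulrDl -?scalerAl.
    exact: MD.
  exact: MZ.
move=> y z hy hz; have h e (k0 : M (e * d0)) (k1 : M (e * d1)) (k2 : M (e * d2)) :=
  span3_sub (sM e) k0 k1 k2 hz.
exact: (span3_sub (sM' z) (h e0 _ _ _) (h e1 _ _ _) (h e2 _ _ _) hy).
Qed.

End Lattices.

(** * Duality over o[u], and monogenic orders are Gorenstein *)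

Section Monogenic.
Variables (F : fieldType) (vF : F -> int) (E : fieldExtType F).
Hypotheses (hF : discrete_valuation vF) (hdeg : \dim {:E} = 3%N).
Variable pi : F.
Hypothesis hpi : uniformizer vF pi.
Local Notation o := (integers vF).
Local Notation "⟨ a , b , c ⟩" := (base_span vF [:: a; b; c]).
Implicit Types (M N I J : set E) (y z w : E).
Variable u : E.
Hypotheses (hu : cubic_basis 1 u (u ^+ 2)) (hu3 : ⟨1, u, u ^+ 2⟩ (u ^+ 3)).
Local Notation O := ⟨1, u, u ^+ 2⟩.
Local Notation phi := (crd2 1 u (u ^+ 2)).

Let sO : osubmodule vF O := span3_submodule hF 1 u (u ^+ 2).

Lemma monogenic_powers : [/\ O 1, O u, O (u ^+ 2), O (u ^+ 3) & O (u ^+ 4)].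
Proof.
have [h0 h1 h2] := span3_gens hF 1 u (u ^+ 2).
split=> //; case/span3P: (hu3) => [a [b [c [oa ob oc e]]]].
rewrite (exprS u 3) e !mulrDr -!scalerAr mulr1 -expr2 -exprS.
exact: (osubmodule_comb sO).
Qed.

Lemma monogenicM y z : O y -> O z -> O (y * z).
Proof.
have [h0 h1 h2 h3 h4] := monogenic_powers.
by apply: (span3_mul sO); rewrite ?mulr1 ?mul1r // -?exprS -?exprSr -?exprD // -expr2.
Qed.

Lemma phi_pow : [/\ phi 1 = 0, phi u = 0 & phi (u ^+ 2) = 1].
Proof. by have [_ [_ h]] := crd_gens hu. Qed.

Lemma phi_linear : linear_form phi.
Proof. by have [] := crd_linear 1 u (u ^+ 2). Qed.

Lemma phi_int y : O y -> o (phi y).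
Proof. by move/(span3_coordP hF hpi hu) => []. Qed.

(** The Gram matrix of [phi (y * z)] in 1, u, u^2 is zero above the antidiagonal and has ones on it.
    Pairing [z] with 1, u, u^2 therefore yields its coordinates [c], [b], [a] in turn, up to
    integral multiples of those already found. *)
Lemma phi_unimodular z : (forall y, O y -> o (phi (z * y))) -> O z.
Proof.
move=> h; have [h0 h1 h2 h3 h4] := monogenic_powers.
have [p0 p1 p2] := phi_pow; have hl := phi_linear.
have ez := crdE hu z; move: ez.
set a := crd0 _ _ _ z; set b := crd1 _ _ _ z; set c := crd2 _ _ _ z => ez.
have oc : o c by have := h _ h0; rewrite mulr1.
have := h _ h1; rewrite ez !mulrDl -!scalerAl mul1r -expr2 -exprSr.
rewrite linform_comb // p1 p2 mulr0 add0r mulr1 => hb.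
have oc3 := integersM hF oc (phi_int h3).
have ob : o b by have := val_geB hF hb oc3; rewrite addrK.
have := h _ h2; rewrite ez !mulrDl -!scalerAl mul1r -exprS -exprD.
rewrite linform_comb // p2 mulr1 => ha.
have oa : o a.
  have := val_geB hF (val_geB hF ha (integersM hF oc (phi_int h4)))
    (integersM hF ob (phi_int h3)); by rewrite !addrK.
by apply/span3P; exists a, b, c; split.
Qed.

(** The same antitriangular system, solved over [F]: the pairing is nondegenerate. *)
Lemma phi_represents (l : E -> F) : linear_form l ->
  exists w, forall z, phi (w * z) = l z.
Proof.
move=> ll; have [p0 p1 p2] := phi_pow; have hl := phi_linear.
pose w2 := l 1; pose w1 := l u - w2 * phi (u ^+ 3).
pose w0 := l (u ^+ 2) - w1 * phi (u ^+ 3) - w2 * phi (u ^+ 4).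
exists (w0 *: 1 + w1 *: u + w2 *: u ^+ 2) => z.
set w := (X in X * z).
have e0 : phi (w * 1) = l 1.
  by rewrite mulr1 linform_comb // p0 p1 p2 !mulr0 !add0r mulr1.
have e1 : phi (w * u) = l u.
  rewrite /w !mulrDl -!scalerAl mul1r -expr2 -exprSr linform_comb // p1 p2.
  by rewrite /w1 mulr0 add0r mulr1 subrK.
have e2 : phi (w * u ^+ 2) = l (u ^+ 2).
  rewrite /w !mulrDl -!scalerAl mul1r -exprS -exprD linform_comb // p2.
  by rewrite /w0 mulr1; ring.
by rewrite [z](crdE hu) !mulrDr -!scalerAr !linform_comb // e0 e1 e2.
Qed.

Definition phi_dual M : set E := [set w | forall z, M z -> o (phi (w * z))].

(** The coordinate forms of the basis of [M] are represented by elements of the dual, so pairing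
    with the dual tests the integrality of each coordinate of [z]. *)
Lemma double_dual M m0 m1 m2 z : cubic_basis m0 m1 m2 -> M = ⟨m0, m1, m2⟩ ->
  (forall w, phi_dual M w -> o (phi (w * z))) -> M z.
Proof.
move=> hm -> h; have [l0 l1 l2] := crd_linear m0 m1 m2.
have [w0 e0] := phi_represents l0; have [w1 e1] := phi_represents l1.
have [w2 e2] := phi_represents l2.
apply/(span3_coordP hF hpi hm); split.
- by rewrite -e0; apply: h => y /(span3_coordP hF hpi hm)[? ? ?]; rewrite e0.
- by rewrite -e1; apply: h => y /(span3_coordP hF hpi hm)[? ? ?]; rewrite e1.
- by rewrite -e2; apply: h => y /(span3_coordP hF hpi hm)[? ? ?]; rewrite e2.
Qed.

Section DualIdeal.
Variable I : set E.
Hypotheses (fI : fractional_ideal O I) (mI : multiplier_ring I = O).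

Let fO : full O := basis_full hF hpi hu.

Let O1 : O 1. Proof. by case: monogenic_powers. Qed.

Let sI : osubmodule vF I.
Proof. by case: fI => -[w ->] _; exact: (module_span_submodule sO O1 monogenicM). Qed.

Let stI y z : O y -> I z -> I (y * z).
Proof. by case: fI => -[w ->] _; exact: (module_span_stable monogenicM). Qed.

Let cI : commensurable_in I O.
Proof.
case: fI => -[w ->] _.
exact: (module_span_commensurable hF hpi sO fO monogenicM).
Qed.

Lemma phi_dual_submodule : osubmodule vF (phi_dual I).
Proof.
have hl := phi_linear; split=> [z Iz|y z hy hz t It|a y oa hy t It].
- by rewrite mul0r linform0 //; left.
- by rewrite mulrDl linformD //; apply: (val_geD hF); [exact: hy|exact: hz].
- by rewrite -scalerAl linformZ //; apply: integersM => //; exact: hy.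
Qed.

Lemma phi_dual_stable y z : O y -> phi_dual I z -> phi_dual I (y * z).
Proof.
by move=> Oy hz t It; rewrite mulrAC mulrC; apply: hz; exact: stI.
Qed.

(** For t in o[u], t y is again in [I], so the pairing of y w with t is integral; self-duality of
    o[u] concludes. *)
Lemma phi_dual_mul y w : I y -> phi_dual I w -> O (y * w).
Proof.
move=> Iy hw; apply: phi_unimodular => t Ot.
by rewrite mulrAC mulrC; apply: hw; rewrite mulrC; apply: stI.
Qed.

Lemma ideal_invertible : invertible_ideal O I.
Proof.
have [y0 Iy0 n0] := fI.2; have hl := phi_linear.
have fullI : full I by exact: (stable_full fO sI Iy0 n0 stI).
have [m0 [m1 [m2 [hm eI]]]] := lattice_basis hF hdeg hpi hu sI fullI cI.
have sJ := phi_dual_submodule.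
(* The dual J satisfies y0 J <= o[u], so a denominator of y0^-1 is one for J. *)
have cJ : commensurable_in (phi_dual I) O.
  have [c c0 hc] := fO y0^-1; exists c => // w hw.
  have := monogenicM hc (phi_dual_mul Iy0 hw).
  by rewrite mulrA -scalerAl mulVf // mulr_algl.
(* If c I and d z lie in o[u], then so does (d c z) I, and [phi] is integral on o[u]. *)
have fullJ : full (phi_dual I).
  move=> z; have [c c0 hc] := cI; have [d d0 hd] := fO z.
  exists (d * c); first by rewrite mulf_neq0.
  move=> t It; have := phi_int (monogenicM hd (hc _ It)).
  by rewrite -!scalerAl -!scalerAr !scalerA.
have [n0' [n1 [n2 [hn eJ]]]] := lattice_basis hF hdeg hpi hu sJ fullJ cJ.
have [k [k0 _ hk]] := full_integral hF hpi 1 sJ fullJ.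
exists (phi_dual I).
  split.
    exists [:: n0'; n1; n2].
    exact: (span3_module_span hF sO O1 eJ phi_dual_stable).
  by exists (k *: 1) => //; exact: scalar_neq0.
have sIJ := ideal_mul_submodule (phi_dual I) sI.
apply/seteqP; split; first by apply: (ideal_mul_sub sO) => y z; exact: phi_dual_mul.
have cIJ : commensurable_in (ideal_mul I (phi_dual I)) O.
  exists 1; first exact: oner_neq0.
  move=> z hz; rewrite scale1r.
  by apply: (ideal_mul_sub sO) hz => y w; exact: phi_dual_mul.
have fIJ : full (ideal_mul I (phi_dual I)).
  move=> z; have [c c0 Ic] := fullI z; exists (c * k); first by rewrite mulf_neq0.
  have := ideal_mul_prod Ic hk.
  by rewrite -scalerAl -scalerAr mulr1 scalerA.
have [p0 [p1 [p2 [hp eIJ]]]] := lattice_basis hF hdeg hpi hu sIJ fIJ cIJ.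
(* Biduality is applied twice. If w is dual to I J, then w I pairs integrally with J, so w I is
   contained in I; hence w lies in the multiplier ring o[u], and w z pairs integrally. *)
move=> z Oz; apply: (double_dual hp eIJ) => w hw.
apply: phi_int; apply: monogenicM => //; rewrite -mI => i Ii.
apply: (double_dual hm eI) => j hj; rewrite mulrCA; apply: hw.
by rewrite mulrC; apply: ideal_mul_prod.
Qed.

End DualIdeal.

Lemma monogenic_gorenstein : gorenstein O.
Proof. by move=> I fI mI; exact: ideal_invertible. Qed.

End Monogenic.

(** * The orders o + pi^k o[u] with k > 0 are not Gorenstein *)

Section NonGorenstein.
Variables (F : fieldType) (vF : F -> int) (E : fieldExtType F).
Hypotheses (hF : discrete_valuation vF) (hdeg : \dim {:E} = 3%N).
Variable pi : F.
Hypothesis hpi : uniformizer vF pi.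
Local Notation o := (integers vF).
Local Notation "⟨ a , b , c ⟩" := (base_span vF [:: a; b; c]).
Variable u : E.
Hypotheses (hu : cubic_basis 1 u (u ^+ 2)) (hu3 : ⟨1, u, u ^+ 2⟩ (u ^+ 3)).
Variable k : nat.
Local Notation O := ⟨1, u, u ^+ 2⟩.
Local Notation Ok := ⟨1, pi ^+ k *: u, pi ^+ k *: u ^+ 2⟩.
Local Notation I := ⟨1, u, pi ^+ k *: u ^+ 2⟩.
Implicit Types y z : E.

Let sO : osubmodule vF O := span3_submodule hF _ _ _.
Let sOk : osubmodule vF Ok := span3_submodule hF _ _ _.
Let sI : osubmodule vF I := span3_submodule hF _ _ _.
Let OM := monogenicM hF hu3.

Let OkP y : Ok y <-> exists a z, [/\ o a, O z & y = a%:A + pi ^+ k *: z].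
Proof.
split=> [/span3P[a [b [c [oa ob oc ->]]]]|[a [z [oa Oz ->]]]].
  exists a, (0 *: 1 + b *: u + c *: u ^+ 2); split=> //.
    by apply/span3P; exists 0, b, c; split=> //; left.
  by rewrite scale0r add0r scalerDr !scalerA addrA ![pi ^+ k * _]mulrC.
case/span3P: Oz => [b [c [d [ob oc od ->]]]]; apply/span3P.
have ok := integers_unifX hF hpi k.
exists (a + pi ^+ k * b), c, d; split=> //.
  by apply: (val_geD hF) => //; exact: integersM.
by rewrite !scalerDr !scalerA scalerDl !addrA ![pi ^+ k * _]mulrC.
Qed.

Let scaled_O z : O z -> I (pi ^+ k *: z).
Proof.
move=> /span3P[b [c [d [ob oc od ->]]]]; apply/span3P.
have ok := integers_unifX hF hpi k.
exists (pi ^+ k * b), (pi ^+ k * c), d; split=> //; try exact: integersM.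
by rewrite !scalerDr !scalerA ![pi ^+ k * _]mulrC.
Qed.

Let I_sub_O : I `<=` O.
Proof.
have [h0 h1 h2] := span3_gens hF 1 u (u ^+ 2).
by apply: span3_sub => //; case: sO => _ _; apply => //; exact: (integers_unifX hF hpi).
Qed.

Let Ok_sub_O : Ok `<=` O.
Proof.
have [h0 h1 h2] := span3_gens hF 1 u (u ^+ 2); have ok := integers_unifX hF hpi k.
by apply: span3_sub => //; case: sO => _ _; apply.
Qed.

Let I_stable y z : Ok y -> I z -> I (y * z).
Proof.
move=> /OkP[a [y' [oa Oy' ->]]] Iz; have [_ ID IZ] := sI.
rewrite mulrDl mulr_algl -scalerAl; apply: ID; first exact: IZ.
by apply: scaled_O; apply: OM => //; exact: I_sub_O.
Qed.

(** Writing the first factor as a + pi^k y', the product is a z plus an element of pi^k o[u], since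
    o[u] is a ring. *)
Lemma conductor_orderM y z : Ok y -> Ok z -> Ok (y * z).
Proof.
move=> /OkP[a [y' [oa Oy' ->]]] Oz; have [_ OD OZ] := sOk.
rewrite mulrDl mulr_algl -scalerAl; apply: OD; first exact: OZ.
apply/OkP; exists 0, (y' * z); rewrite scale0r add0r.
by split=> //; [left|apply: OM => //; exact: Ok_sub_O].
Qed.

(** If y = a + b u + c u^2 multiplies I into itself, then y itself is in I, so pi^k divides c; the
    u^2-coordinate of y u is b + c [phi (u ^+ 3)], which forces pi^k to divide b as well. *)
Let mI : multiplier_ring I = Ok.
Proof.
have [p0 p1 p2] := phi_pow hu; have [h0 h1 h2] := span3_gens hF 1 u (pi ^+ k *: u ^+ 2).
have IP y : I y <-> [/\ o (crd0 1 u (u ^+ 2) y), o (crd1 1 u (u ^+ 2) y)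
    & val_ge vF k (crd2 1 u (u ^+ 2) y)].
  by have := span3_scaledP hF hpi hu 0 k y; rewrite expr0 scale1r.
apply/seteqP; split=> y hy; last by move=> z; exact: I_stable.
have := hy _ h0; rewrite mulr1 => Iy; have := hy _ h1 => Iyu.
apply/(span3_scaledP hF hpi hu); case/IP: (Iy) => oa ob oc; split=> //.
case/IP: Iyu => _ _; rewrite {1}[y](crdE hu) !mulrDl -!scalerAl mul1r -expr2 -exprSr.
have [_ _ hl] := crd_linear 1 u (u ^+ 2).
rewrite linform_comb // p1 p2 mulr0 add0r mulr1 => hb.
have [_ _ _ O3 _] := monogenic_powers hF hu3.
have := val_geM hF oc (phi_int hF hpi hu O3); rewrite addr0 => hc.
by have := val_geB hF hb hc; rewrite addrK.
Qed.

Lemma not_gorenstein_conductor_order : (0 < k)%N -> ~ gorenstein Ok.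
Proof.
move=> k_gt0 gO; have [h0 h1 h2] := span3_gens hF 1 u (pi ^+ k *: u ^+ 2).
have [O1 _ _] := span3_gens hF 1 (pi ^+ k *: u) (pi ^+ k *: u ^+ 2).
have [|J _ IJ] := gO I _ mI.
  split; last by exists 1 => //; exact: oner_neq0.
  exists [:: 1; u; pi ^+ k *: u ^+ 2].
  exact: (span3_module_span hF sOk O1 _ I_stable).
have IJO y z : I y -> J z -> Ok (y * z) by rewrite -IJ; exact: ideal_mul_prod.
(* The generators of o[u] are products of two elements of I, namely 1 * 1, u * 1 and u * u, so o[u]
   J J is contained in (I J)(I J). *)
have JJ j j' t : J j -> J j' -> O t -> Ok (t * (j * j')).
  move=> Jj Jj' Ot; have [OkM OD OZ] := sOk.
  have sS : osubmodule vF [set t | Ok (t * (j * j'))].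
    split=> [|y z hy hz|a y oa hy] /=; first by rewrite mul0r.
      by rewrite mulrDl; apply: OD.
    by rewrite -scalerAl; apply: OZ.
  apply: (span3_sub sS _ _ _ Ot) => /=.
  - have -> : 1 * (j * j') = (1 * j) * (1 * j') by ring.
    by apply: conductor_orderM; apply: IJO.
  - have -> : u * (j * j') = (u * j) * (1 * j') by ring.
    by apply: conductor_orderM; apply: IJO.
  - have -> : u ^+ 2 * (j * j') = (u * j) * (u * j') by ring.
    by apply: conductor_orderM; apply: IJO.
(* Expanding both factors of (I J)(I J) leaves u i i' in o[u] times j j', which the previous step
   covers. *)
have mulu y z : ideal_mul I J y -> ideal_mul I J z -> Ok (u * (y * z)).
  have [Ok0 OD OZ] := sOk.
  have sS t : osubmodule vF [set z | Ok (u * (t * z))].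
    split=> [|a b hy hz|a b oa hy] /=; first by rewrite !mulr0.
      by rewrite !mulrDr; apply: OD.
    by rewrite -!scalerAr; apply: OZ.
  have sS' t : osubmodule vF [set y | Ok (u * (y * t))].
    split=> [|a b hy hz|a b oa hy] /=; first by rewrite mul0r mulr0.
      by rewrite mulrDl mulrDr; apply: OD.
    by rewrite -scalerAl -scalerAr; apply: OZ.
  move=> hy hz; apply: (ideal_mul_sub (sS' z)) hy => i j Ii Jj /=.
  apply: (ideal_mul_sub (sS (i * j))) hz => i' j' Ii' Jj' /=.
  have -> : u * (i * j * (i' * j')) = (u * (i * i')) * (j * j') by ring.
  apply: JJ => //; apply: OM; first by apply: I_sub_O.
  by apply: OM; apply: I_sub_O.
(* As 1 lies in I J, this puts u in the order, whose elements have u-coordinate divisible by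
   pi^k. *)
have : Ok (u * (1 * 1)) by apply: mulu; rewrite IJ.
rewrite !mulr1 => /(span3_scaledP hF hpi hu)[_ + _].
have [_ [[_ -> _] _]] := crd_gens hu.
case=> [/eqP|]; first by rewrite oner_eq0.
by rewrite (valuation1 hF) lez_nat leqNgt k_gt0.
Qed.

End NonGorenstein.

Lemma monogenic_conductor_gorenstein (F : fieldType) (vF : F -> int)
    (hF : discrete_valuation vF) (E : fieldExtType F) (hdeg : \dim {:E} = 3%N)
    (pi : F) (hpi : uniformizer vF pi) (u : E) (k : nat) :
  cubic_basis 1 u (u ^+ 2) -> base_span vF [:: 1; u; u ^+ 2] (u ^+ 3) ->
  gorenstein (base_span vF [:: 1; pi ^+ k *: u; pi ^+ k *: u ^+ 2]) <-> k = 0%N.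
Proof.
move=> hu hu3; split=> [gO|->]; last first.
  by rewrite expr0 !scale1r; exact: (monogenic_gorenstein hF hdeg hpi hu hu3).
have [//|k_gt0] := posnP k.
by case: (not_gorenstein_conductor_order hF hpi hu hu3 k_gt0).
Qed.

(** * The length of a quotient of lattices *)

Section IndexLength.
Variables (F : fieldType) (vF : F -> int) (E : fieldExtType F).
Hypotheses (hF : discrete_valuation vF).
Variable pi : F.
Hypothesis hpi : uniformizer vF pi.
Local Notation o := (integers vF).
Local Notation "⟨ a , b , c ⟩" := (base_span vF [:: a; b; c]).
Variables e0 e1 e2 : E.
Hypothesis he : cubic_basis e0 e1 e2.
Implicit Types (C M : set E) (y z : E).
Local Notation c1 := (crd1 e0 e1 e2).
Local Notation c2 := (crd2 e0 e1 e2).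
Local Notation lat i j := ⟨e0, pi ^+ i *: e1, pi ^+ j *: e2⟩.

Lemma scaled_gen1 i j k : lat i j (pi ^+ k *: e1) <-> (i <= k)%N.
Proof.
have [l0 l1 l2] := crd_linear e0 e1 e2.
have [[g00 g01 g02] [[g10 g11 g12] [g20 g21 g22]]] := crd_gens he.
rewrite (span3_scaledP hF hpi he) !linformZ // g01 g11 g21 !mulr0 mulr1.
by split=> [[_ h h']|ik]; [apply/(val_ge_unifXP hF hpi)|
  split; by [left|apply/(val_ge_unifXP hF hpi)]].
Qed.

Lemma scaled_gen2 i j k : lat i j (pi ^+ k *: e2) <-> (j <= k)%N.
Proof.
have [l0 l1 l2] := crd_linear e0 e1 e2.
have [[g00 g01 g02] [[g10 g11 g12] [g20 g21 g22]]] := crd_gens he.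
rewrite (span3_scaledP hF hpi he) !linformZ // g02 g12 g22 !mulr0 mulr1.
by split=> [[_ h h']|ik]; [apply/(val_ge_unifXP hF hpi)|
  split; by [left|apply/(val_ge_unifXP hF hpi)]].
Qed.

Lemma scaled_sub i j i' j' : (i' <= i)%N -> (j' <= j)%N ->
  lat i j `<=` lat i' j'.
Proof.
move=> ii jj z /(span3_scaledP hF hpi he)[h0 h1 h2].
apply/(span3_scaledP hF hpi he); split=> //; [apply: val_ge_le h1|apply: val_ge_le h2];
  lia.
Qed.

(* (al, be) are the exponents of the diagonal of the Hermite normal form of C. *)
Let hermite C al be :=
  [/\ exists2 z, C z & c1 z = pi ^+ al,
      forall z, C z -> val_ge vF al (c1 z),
      exists z, [/\ C z, c1 z = 0 & c2 z = pi ^+ be]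
    & forall z, C z -> c1 z = 0 -> val_ge vF be (c2 z)].

(** Lying between two lattices makes the two coordinate ideals integral and nonzero; no generators
    of [C] are needed. *)
Lemma hermite_exists C i j : osubmodule vF C -> lat i j `<=` C ->
  C `<=` ⟨e0, e1, e2⟩ -> exists al be, hermite C al be.
Proof.
move=> sC NC CM; have [C0 CD CZ] := sC.
have [l0 l1 l2] := crd_linear e0 e1 e2.
have [[g00 g01 g02] [[g10 g11 g12] [g20 g21 g22]]] := crd_gens he.
have Ce1 : C (pi ^+ i *: e1) by apply: NC; apply/scaled_gen1.
have Ce2 : C (pi ^+ j *: e2) by apply: NC; apply/scaled_gen2.
have CMP z : C z -> [/\ o (crd0 e0 e1 e2 z), o (c1 z) & o (c2 z)].
  by move/CM/(span3_coordP hF hpi he).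
have [| | |al [[za Cza eza] hal]] := @ideal_gen _ vF hF pi hpi [set c1 z | z in C].
- by move=> _ [z Cz <-]; case: (CMP z).
- move=> a _ oa [z Cz <-]; exists (a *: z); first exact: CZ.
  by rewrite linformZ.
- exists (pi ^+ i); last exact: (unifX_neq0 hpi).
  by exists (pi ^+ i *: e1); rewrite // linformZ // g11 mulr1.
have [| | |be [[zb [Czb z1] ezb] hbe]] :=
  @ideal_gen _ vF hF pi hpi [set c2 z | z in [set z | C z /\ c1 z = 0]].
- by move=> _ [z [Cz _] <-]; case: (CMP z).
- move=> a _ oa [z [Cz ez] <-]; exists (a *: z); last by rewrite linformZ.
  by split; [exact: CZ|rewrite linformZ // ez mulr0].
- exists (pi ^+ j); last exact: (unifX_neq0 hpi).
  exists (pi ^+ j *: e2); last by rewrite linformZ // g22 mulr1.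
  by split; rewrite // linformZ // g12 mulr0.
exists al, be; split.
- by exists za.
- by move=> z Cz; apply: hal; exists z.
- by exists zb.
- by move=> z Cz ez; apply: hbe; exists z.
Qed.

Lemma hermite_mono C C' al be al' be' : hermite C al be -> hermite C' al' be' ->
  C `<=` C' -> (al' <= al)%N /\ (be' <= be)%N.
Proof.
move=> [[za Cza eza] _ [zb [Czb ezb1 ezb]] _] [_ hal _ hbe] CC; split.
  by apply/(val_ge_unifXP hF hpi); rewrite -eza; apply: hal; apply: CC.
by apply/(val_ge_unifXP hF hpi); rewrite -ezb; apply: hbe; rewrite //; apply: CC.
Qed.

(** With equal diagonals, the elements [za] and [zb] of the smaller module clear the last two
    coordinates of any element of the larger one. An integral multiple of [e0] remains, and [e0]
    lies in both. *)
Lemma hermite_eq C C' al be i j : osubmodule vF C -> osubmodule vF C' ->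
  lat i j `<=` C -> C' `<=` ⟨e0, e1, e2⟩ ->
  hermite C al be -> hermite C' al be -> C `<=` C' -> C' `<=` C.
Proof.
move=> sC sC' NC CM [[za Cza eza] _ [zb [Czb ezb1 ezb]] _] [_ hal _ hbe] CC z Cz.
have [l0 l1 l2] := crd_linear e0 e1 e2.
have [C0 CD CZ] := sC; have [_ _ CZ'] := sC'.
have [a oa ea] := (val_ge_unifP hF hpi _ _).1 (hal z Cz).
have Cz1 : C' (z - a *: za).
  by apply: (osubmoduleB hF) => //; apply: CZ' => //; apply: CC.
have z1 : c1 (z - a *: za) = 0 by rewrite linformB // linformZ // ea eza mulrC subrr.
have [b ob eb] := (val_ge_unifP hF hpi _ _).1 (hbe _ Cz1 z1).
have Cz2 : C' (z - a *: za - b *: zb).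
  by apply: (osubmoduleB hF) => //; apply: CZ' => //; apply: CC.
have e : z - a *: za - b *: zb = crd0 e0 e1 e2 (z - a *: za - b *: zb) *: e0.
  rewrite {1}[LHS](crdE he) (linformB l1) z1 linformZ // ezb1 mulr0 subrr.
  by rewrite (linformB l2) eb linformZ // ezb mulrC subrr !scale0r !addr0.
have -> : z = z - a *: za - b *: zb + b *: zb + a *: za by rewrite !subrK.
apply: (CD); last exact: CZ; apply: (CD); last exact: CZ.
rewrite e; apply: CZ; first by have /(span3_coordP hF hpi he)[] := CM _ Cz2.
apply: NC; by have [] := span3_gens hF e0 (pi ^+ i *: e1) (pi ^+ j *: e2).
Qed.

(** The sum of the two diagonal exponents is at most i + j at the bottom of a chain and drops at
    each strict inclusion, which bounds the length from above. *)
Lemma scaled_length i j :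
  quotient_length (@base_integers _ vF E) ⟨e0, e1, e2⟩ (lat i j) (i + j).
Proof.
have M0 : ⟨e0, e1, e2⟩ = lat 0 0 by rewrite !expr0 !scale1r.
split.
  (* Truncated subtraction makes the first exponent descend from i to 0 while the second stays at j,
     and only then the second descend. *)
  exists (fun l => lat (i - l) (j - (l - i))); split=> l li.
    split; [|by apply: scaled_sub; lia|by rewrite M0; apply: scaled_sub; lia].
    by apply/osubmoduleP; exact: (span3_submodule hF).
  split; first by apply: scaled_sub; lia.
  move=> h; have [lt_li|ge_li] := ltnP l i.
    have /h : lat (i - l.+1) (j - (l.+1 - i)) (pi ^+ (i - l.+1) *: e1).
      exact/scaled_gen1.
    by move/scaled_gen1; lia.
  have /h : lat (i - l.+1) (j - (l.+1 - i)) (pi ^+ (j - (l.+1 - i)) *: e2).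
    exact/scaled_gen2.
  by move/scaled_gen2; lia.
move=> l C [hC sC].
have hP k : (k <= l)%N ->
    [/\ osubmodule vF (C k), lat i j `<=` C k & C k `<=` ⟨e0, e1, e2⟩].
  by move/hC => [/osubmoduleP].
suff key k : (k <= l)%N -> forall al be, hermite (C k) al be ->
    (k + (al + be) <= i + j)%N.
  have [sM NM MM] := hP _ (leqnn l).
  have [al [be h]] := hermite_exists sM NM MM.
  by have := key _ (leqnn l) _ _ h; lia.
elim: k => [|k IH] kl al be h.
  have [sM NM MM] := hP _ kl; case: h => [_ hal _ hbe].
  have [l0 l1 l2] := crd_linear e0 e1 e2.
  have [[g00 g01 g02] [[g10 g11 g12] [g20 g21 g22]]] := crd_gens he.
  have : (al <= i)%N.
    apply/(val_ge_unifXP hF hpi); rewrite -[pi ^+ i]mulr1 -g11 -linformZ //.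
    by apply: hal; apply: NM; apply/scaled_gen1.
  have : (be <= j)%N.
    apply/(val_ge_unifXP hF hpi); rewrite -[pi ^+ j]mulr1 -g22 -linformZ //.
    apply: hbe; first by apply: NM; apply/scaled_gen2.
    by rewrite linformZ // g12 mulr0.
  lia.
have kl' := ltnW kl; have [sM NM MM] := hP _ kl'; have [sM' NM' MM'] := hP _ kl.
have [al0 [be0 h0]] := hermite_exists sM NM MM.
have [CC nCC] := sC _ kl.
have [ha hb] := hermite_mono h0 h CC.
have := IH kl' _ _ h0.
(* Both exponents are weakly decreasing, and if neither changed the two members of the chain would
   coincide. *)
have : al != al0 \/ be != be0.
  apply: contrapT => /not_orP[/negP + /negP]; rewrite !negbK => /eqP ea /eqP eb.
  by subst al be; apply: nCC; exact: (hermite_eq sM sM' NM MM' h0 h).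
lia.
Qed.

End IndexLength.

(** * Conductor exponents, and orders containing a given element *)

Section Frames.
Variables (F : fieldType) (vF : F -> int) (E : fieldExtType F) (vE : E -> int).
Hypotheses (hF : discrete_valuation vF) (hE : discrete_valuation vE).
Hypotheses (hdeg : \dim {:E} = 3%N) (hram : totally_ramified vF vE).
Variables (pi : F) (x : E).
Hypotheses (hpi : uniformizer vF pi) (hx : uniformizer vE x).
Local Notation o := (integers vF).
Local Notation "⟨ a , b , c ⟩" := (base_span vF [:: a; b; c]).
Implicit Types (y z e : E).

Lemma integers_full : full (integers vE).
Proof.
rewrite (integers_power_basis hF hE hdeg hram hpi hx).
by apply: (basis_full hF hpi); exact: (power_basis hE hdeg hram hx).
Qed.

(** If some z in the conductor had valuation below f, then y / z would be integral, and y = z (y /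
    z) would lie in [O]. So one excluded element of valuation at least f - 1 pins the exponent. *)
Lemma conductor_exponentP (O : set E) (f : nat) :
  (forall z, val_ge vE f z -> O z) ->
  (f = 0%N \/ exists2 y, val_ge vE (f%:Z - 1) y & ~ O y) ->
  conductor_exponent vE x O f.
Proof.
move=> hO hf; apply/seteqP; split=> z.
  move=> [intz hz]; suff /(val_ge_unifP hE hx)[b ib ->] : val_ge vE f z by exists b.
  case: hf => [->//|[y yf nOy]]; apply: contrapT => nz.
  have z0 : z != 0 by apply/eqP => z0; apply: nz; left.
  apply: nOy; rewrite -[y](divfK z0) mulrC; apply: hz.
  apply: (val_ge_div hE z0); rewrite addr0; apply: val_ge_le yf.
  rewrite lerBrDr lezD1 ltNge; apply/negP => h.
  by apply: nz; right.
move=> [b ib <-]; have hxf := val_ge_unifX hE hx (leqnn f).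
have h : val_ge vE f (x ^+ f * b) by rewrite -[f%:Z]addr0; apply: (val_geM hE).
split; first by apply: val_ge_le h.
by move=> b' ib'; apply: hO; rewrite -[f%:Z]addr0; apply: (val_geM hE).
Qed.

Lemma conductor_exponent_inj (O : set E) f f' :
  conductor_exponent vE x O f -> conductor_exponent vE x O f' -> f = f'.
Proof.
move=> h h'; suff key g g' : conductor_exponent vE x O g ->
    conductor_exponent vE x O g' -> (g <= g')%N.
  by apply/eqP; rewrite eqn_leq !key.
rewrite /conductor_exponent => -> /seteqP[_ /(_ (x ^+ g'))].
case; first by exists 1; rewrite ?mulr1 //; exact: (integers1 hE).
by move=> b ib e; apply/(val_ge_unifXP hE hx); apply/(val_ge_unifP hE hx); exists b.
Qed.

Lemma quotient_length_inj (A M N : set E) k k' :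
  quotient_length A M N k -> quotient_length A M N k' -> k = k'.
Proof.
move=> [[C hC] h] [[C' hC'] h']; apply/eqP; rewrite eqn_leq.
by rewrite (h' _ _ hC) (h _ _ hC').
Qed.

Lemma adjoin_integers_sub (O : set E) y : is_order vF O ->
  adjoin_integers vF y `<=` O <-> O y.
Proof.
move=> [[O1 OB OM] oO _ _]; split=> [|Oy z [p hp ->]].
  apply; exists 'X; last by rewrite map_polyX hornerX.
  by move=> i; rewrite coefX; case: eqP => _; [exact: (integers1 hF)|left].
have {}O1 : O 1 by exact: set_mem.
have {}OM a b : O a -> O b -> O (a * b).
  by move=> /mem_set Oa /mem_set Ob; apply: set_mem; apply: OM.
have O0 : O 0 by apply: oO; exists 0; [left|rewrite scale0r].
have OD a b : O a -> O b -> O (a + b).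
  move: O0 => /mem_set O0 /mem_set Oa /mem_set Ob; apply: set_mem.
  by rewrite -[b]opprK; apply: (OB) => //; rewrite -sub0r; apply: OB.
rewrite horner_coef; elim/big_ind: _ => // i _; rewrite coef_map; apply: (OM).
  by apply: oO; exists p`_i.
by elim: (val i) => [|m IH]; rewrite ?expr0 // exprS; apply: OM.
Qed.

(** * The lattices L(b, a) of a frame with [e1 ^+ 2 = r + t e1 + p e2] *)

Section Frame.
Variables (e1 e2 : E) (eps : nat) (r t p : F).
Hypotheses (hO : integers vE = ⟨1, e1, e2⟩).
Hypotheses (e1sq : e1 ^+ 2 = r%:A + t *: e1 + p *: e2).
Hypotheses (or : o r) (ot : o t) (p0 : p != 0) (vp : vF p = eps).
Local Notation c0 := (crd0 1 e1 e2).
Local Notation c1 := (crd1 1 e1 e2).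
Local Notation c2 := (crd2 1 e1 e2).
Local Notation lat b a := ⟨1, pi ^+ b *: e1, pi ^+ a *: e2⟩.

Lemma frame_basis : cubic_basis 1 e1 e2.
Proof.
by apply: (full_basis hdeg (vF := vF)); rewrite -hO; exact: integers_full.
Qed.

Let gens : [/\ integers vE 1, integers vE e1 & integers vE e2].
Proof. by rewrite hO; exact: (span3_gens hF). Qed.

Lemma lat_gens b a : [/\ lat b a 1, lat b a (pi ^+ b *: e1) & lat b a (pi ^+ a *: e2)].
Proof. exact: (span3_gens hF). Qed.

Lemma latP b a z : lat b a z <->
  [/\ o (c0 z), val_ge vF b (c1 z) & val_ge vF a (c2 z)].
Proof. exact: (span3_scaledP hF hpi frame_basis). Qed.

Lemma lat_integers b a : lat b a `<=` integers vE.
Proof.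
have := scaled_sub hF hpi frame_basis (leq0n b) (leq0n a).
by rewrite !expr0 !scale1r -hO.
Qed.

(** By total ramification, valuation at least 3a means membership in pi^a O_E, and pi^a O_E lies in
    L(b, a) as b <= a. *)
Lemma lat_conductor b a z : (b <= a)%N -> val_ge vE (3 * a%:Z) z -> lat b a z.
Proof.
move=> ba hz; have pa0 := unifX_neq0 hpi a.
have : integers vE ((pi ^+ a)^-1 *: z).
  apply/(val_ge_scale_unif hF hE hdeg hram hpi 0 a).
  by rewrite scalerA divff // scale1r addr0.
rewrite hO => /(span3_coordP hF hpi frame_basis)[i0 i1 i2].
rewrite -[z](scale1r z) -(divff pa0) -scalerA.
have [l0 l1 l2] := crd_linear 1 e1 e2.
move: (_ *: z) i0 i1 i2 => w i0 i1 i2; apply/latP; rewrite !linformZ //.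
have hpa := val_ge_unifX hF hpi (leqnn a).
split; first by apply: integersM => //; exact: (integers_unifX hF hpi).
  apply: (@val_ge_le _ _ _ a%:Z); first by rewrite lez_nat.
  by rewrite -[a%:Z]addr0; apply: (val_geM hF).
by rewrite -[a%:Z]addr0; apply: (val_geM hF).
Qed.

Lemma lat_full b a : (b <= a)%N -> full (lat b a).
Proof.
move=> ba z; have [c c_0 hc] := integers_full z.
exists (pi ^+ a * c); first by rewrite mulf_neq0 ?(unifX_neq0 hpi).
apply: lat_conductor => //; rewrite -scalerA -[3 * _]addr0.
exact/(val_ge_scale_unif hF hE hdeg hram hpi).
Qed.

(** The coordinates of the square are pi^(2b) times r, t and p; the first two are harmless and the
    last has valuation 2b + [eps]. *)
Let lat_e1sq b a : lat b a ((pi ^+ b *: e1) * (pi ^+ b *: e1)) <-> (a <= b + b + eps)%N.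
Proof.
rewrite -scalerAl -scalerAr scalerA -exprD -expr2 e1sq !scalerDr !scalerA.
have [_ _ h] := crd_comb frame_basis (pi ^+ (b + b) * r) (pi ^+ (b + b) * t)
  (pi ^+ (b + b) * p).
have [h0 h1 _] := crd_comb frame_basis (pi ^+ (b + b) * r) (pi ^+ (b + b) * t)
  (pi ^+ (b + b) * p).
have nz : pi ^+ (b + b) * p != 0 by rewrite mulf_neq0 ?(unifX_neq0 hpi).
have vv : vF (pi ^+ (b + b) * p) = (b + b + eps)%N.
  by rewrite (valuation_mul hF) ?(unifX_neq0 hpi) // (val_unifX hF hpi) vp; lia.
split=> [/latP[_ _]|hab]; first by rewrite h val_geP // vv; lia.
apply/latP; rewrite h0 h1 h; split.
- by apply: integersM => //; exact: (integers_unifX hF hpi).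
- rewrite -[b%:Z]addr0; apply: (val_geM hF) => //.
  by apply: (val_ge_unifX hF hpi); lia.
- by rewrite val_geP // vv; lia.
Qed.

Lemma lat_order b a : (b <= a)%N -> is_order vF (lat b a) <-> (a <= b + b + eps)%N.
Proof.
move=> ba; have [g0 g1 g2] := lat_gens b a.
have sL := span3_submodule hF 1 (pi ^+ b *: e1) (pi ^+ a *: e2).
have [i0 i1 i2] := gens.
split=> [[[_ _ LM] _ _ _]|hab].
  by apply/lat_e1sq; apply: set_mem; apply: LM; apply: mem_set.
have La y z : integers vE y -> integers vE z -> lat b a (y * (pi ^+ a *: z)).
  move=> iy iz; apply: lat_conductor => //; rewrite -scalerAr -[3 * _]addr0.
  by apply/(val_ge_scale_unif hF hE hdeg hram hpi); exact: (integersM hE).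
have i1' : integers vE (pi ^+ b *: e1) by exact: (lat_integers g1).
have i2' : integers vE (pi ^+ a *: e2) by exact: (lat_integers g2).
split.
- split; first exact: mem_set.
    by move=> y z /set_mem hy /set_mem hz; apply: mem_set; exact: (osubmoduleB hF).
  move=> y z /set_mem hy /set_mem hz; apply: mem_set.
  move: y z hy hz; apply: (span3_mul sL);
    rewrite ?mul1r ?mulr1 //; [exact/lat_e1sq|exact: La|by rewrite mulrC; apply: La|exact: La].
- by move=> _ [c oc <-]; case: sL => _ _; apply.
- by exists [:: 1; pi ^+ b *: e1; pi ^+ a *: e2].
- move=> z; exists [:: 1; pi ^+ b *: e1; pi ^+ a *: e2].
    by move=> y; rewrite !inE => /or3P[] /eqP ->.
  have := full_basis hdeg (lat_full ba); rewrite /cubic_basis => /span_basis ->.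
  exact: memvf.
Qed.

Lemma lat_length b a : order_length vF vE (lat b a) (a + b).
Proof. by rewrite /order_length hO addnC; exact: (scaled_length hF hpi frame_basis). Qed.

Lemma lat_not_conductor b a : (0 < a)%N -> ~ lat b a (pi ^+ a.-1 *: e2).
Proof. by case: a => // a _ /(scaled_gen2 hF hpi frame_basis); rewrite ltnn. Qed.

(** The two inequalities make [d] and [k] nonnegative, with k + d = b and k + 2d = a - [eps]. Thus
    pi^k u = pi^b e1, while pi^k u^2 = pi^(a - eps) e1^2 equals a unit times pi^a e2 modulo the
    other two generators, so L(b, a) = o + pi^k o[u]. *)
Lemma lat_gorenstein b a : (b + eps <= a)%N -> (a <= b + b + eps)%N ->
  gorenstein (lat b a) <-> a = (b + b + eps)%N.
Proof.
move=> ba hab; pose d := (a - b - eps)%N; pose k := (b + b + eps - a)%N.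
pose u := pi ^+ d *: e1; pose p' := p / pi ^+ eps.
have pX := unifX_neq0 hpi.
have p'0 : p' != 0 by rewrite mulf_neq0 ?invr_eq0.
have op' : o p'^-1.
  apply: (integers_unit_inv hF) => //; rewrite /p' (valuation_mul hF) ?invr_eq0 //.
  by rewrite (valuationV hF) // (val_unifX hF hpi) vp subrr.
have ep : p = pi ^+ eps * p' by rewrite /p' mulrC divfK.
have oX := integers_unifX hF hpi.
have op'' : o p'.
  by right; rewrite /p' (valuation_mul hF) ?invr_eq0 // (valuationV hF) //
    (val_unifX hF hpi) vp subrr.
have ku : pi ^+ k *: u = pi ^+ b *: e1.
  by rewrite /u scalerA -exprD; congr (pi ^+ _ *: _); lia.
have ku2 : pi ^+ k *: u ^+ 2 = (pi ^+ (a - eps) * r) *: 1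
    + (pi ^+ (a - eps - b) * t) *: (pi ^+ b *: e1) + p' *: (pi ^+ a *: e2).
  rewrite /u exprZn [LHS]scalerA -exprM -exprD e1sq !scalerDr !scalerA.
  have -> : (k + d * 2 = a - eps)%N by lia.
  congr (_ + _ *: _ + _ *: _).
    by rewrite [RHS]mulrAC -exprD; congr (pi ^+ _ * _); lia.
  by rewrite ep mulrA -exprD mulrC; congr (_ * pi ^+ _); lia.
have addBB (A B C : E) : A + B + C - A - B = C by ring.
have eL : lat b a = ⟨1, pi ^+ k *: u, pi ^+ k *: u ^+ 2⟩.
  have [g0 g1 g2] := span3_gens hF 1 (pi ^+ k *: u) (pi ^+ k *: u ^+ 2).
  have [h0 h1 h2] := lat_gens b a.
  have sL := span3_submodule hF 1 (pi ^+ b *: e1) (pi ^+ a *: e2).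
  have sU := span3_submodule hF 1 (pi ^+ k *: u) (pi ^+ k *: u ^+ 2).
  apply/seteqP; split; apply: span3_sub => //.
  - by rewrite -ku.
  - have -> : pi ^+ a *: e2 = p'^-1 *: (pi ^+ k *: u ^+ 2 - (pi ^+ (a - eps) * r) *: 1
        - (pi ^+ (a - eps - b) * t) *: (pi ^+ k *: u)).
      by rewrite ku2 ku addBB scalerK.
    have [_ _ UZ] := sU; apply: (UZ) => //.
    by do 2?[apply: (osubmoduleB hF) => //]; apply: UZ => //; apply: integersM.
  - by rewrite ku.
  - by rewrite ku2; apply: (osubmodule_comb sL) => //; apply: integersM.
have hu : cubic_basis 1 u (u ^+ 2).
  apply: (full_basis hdeg (vF := vF)).
  have ba' : (b <= a)%N by lia.
  apply: full_subset (lat_full ba'); rewrite eL.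
  have [g0 g1 g2] := span3_gens hF 1 u (u ^+ 2).
  have sU := span3_submodule hF 1 u (u ^+ 2); have [_ _ UZ] := sU.
  by apply: span3_sub => //; apply: UZ.
(* An integral cubic equation for e1, even when e2 is not in o[e1]: in e1^3 = r e1 + t e1^2 + p e1
   e2 the product e1 e2 is expanded over 1, e1, e2, and the resulting multiple of p e2 is eliminated
   through e1^2. Scaling by powers of pi^d gives the equation for u. *)
have hu3 : ⟨1, u, u ^+ 2⟩ (u ^+ 3).
  have [_ i1 i2] := gens; have := integersM hE i1 i2.
  rewrite -/(integers vE _) hO => /span3P[a' [b' [c' [oa ob oc e12]]]].
  have op : o p by right; rewrite vp.
  have e13 : e1 ^+ 3 = (p * a' - c' * r) *: 1 + (r + p * b' - c' * t) *: e1
      + (t + c') *: e1 ^+ 2.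
    rewrite exprSr e1sq !mulrDl -!scalerAl mul1r -expr2 [e2 * _]mulrC e12 e1sq.
    have pe2 : p *: e2 = e1 ^+ 2 - r%:A - t *: e1.
      by rewrite e1sq addBB.
    have -> : p *: (a'%:A + b' *: e1 + c' *: e2) =
        (p * a') *: 1 + (p * b') *: e1 + c' *: (p *: e2).
      by rewrite !scalerDr !scalerA [c' * p]mulrC.
    rewrite pe2 e1sq; have sc (c : F) (y : E) : c *: y = in_alg E c * y.
      by rewrite in_algE mulr_algl.
    by rewrite !sc !(rmorphB, rmorphD, rmorphM); ring.
  apply/span3P.
  exists (pi ^+ (d * 3) * (p * a' - c' * r)), (pi ^+ (d * 2) * (r + p * b' - c' * t)),
    (pi ^+ d * (t + c')).
  split.
  - by apply: integersM => //; apply: (val_geB hF); apply: integersM.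
  - apply: integersM => //; apply: (val_geB hF); last exact: integersM.
    by apply: (val_geD hF) => //; exact: integersM.
  - by apply: integersM => //; exact: (val_geD hF).
  rewrite /u !exprZn -!exprM e13 !scalerDr !scalerA; congr (_ + _ *: _ + _ *: _).
    by rewrite [RHS]mulrAC -exprD; congr (pi ^+ _ * _); lia.
  by rewrite [RHS]mulrAC -exprD; congr (pi ^+ _ * _); lia.
rewrite eL (monogenic_conductor_gorenstein hF hdeg hpi k hu hu3) /k; split; lia.
Qed.

End Frame.

End Frames.

(** * Normal forms of orders and the two kinds of frames *)

Section Classification.
Variables (F : fieldType) (vF : F -> int) (E : fieldExtType F) (vE : E -> int).
Hypotheses (hF : discrete_valuation vF) (hE : discrete_valuation vE).
Hypotheses (hdeg : \dim {:E} = 3%N) (hram : totally_ramified vF vE).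
Variables (pi : F) (x : E).
Hypotheses (hpi : uniformizer vF pi) (hx : uniformizer vE x).
Local Notation o := (integers vF).
Local Notation "⟨ a , b , c ⟩" := (base_span vF [:: a; b; c]).
Implicit Types (O M : set E) (y z : E) (e : F).

Lemma order_submodule O : is_order vF O -> osubmodule vF O.
Proof.
move=> [[O1 OB OM] oO _ _]; have O0 : 0 \in O.
  by apply: mem_set; apply: oO; exists 0; [left|rewrite scale0r].
split=> [|y z /mem_set Oy /mem_set Oz|a y oa /mem_set Oy]; apply: set_mem => //.
  by rewrite -[z]opprK; apply: (OB) => //; rewrite -sub0r; apply: OB.
by rewrite -mulr_algl; apply: OM => //; apply: mem_set; apply: oO; exists a.
Qed.

Lemma orderM O y z : is_order vF O -> O y -> O z -> O (y * z).
Proof.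
by move=> [[_ _ OM] _ _ _] /mem_set Oy /mem_set Oz; apply: set_mem; apply: OM.
Qed.

Lemma order_one O : is_order vF O -> O 1.
Proof. by move=> [[O1 _ _] _ _ _]; apply: set_mem. Qed.

(* Powers of an element of negative valuation are unbounded. *)
Lemma order_sub_integers O : is_order vF O -> O `<=` integers vE.
Proof.
move=> oO; have [_ _ [w ew] _] := oO.
have [N hN] : exists N : int, forall y, y \in w -> val_ge vE N y.
  elim: (w) => [|y l [N hN]]; first by exists 0.
  exists (Order.min N (vE y)) => z; rewrite inE => /predU1P[->|/hN].
    by right; rewrite ge_min lexx orbT.
  by apply: val_ge_le; rewrite ge_min lexx.
have hO z : O z -> val_ge vE N z.
  rewrite ew => -[a [ha ->]]; apply: (val_ge_sum hE) => i _.
  rewrite -[N]add0r; apply: (val_geM hE); last by apply: hN; apply: mem_nth.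
  have [b ob <-] := ha i; rewrite -[0](mulr0 3) -[3 * 0]addr0.
  by apply: (val_ge_scale hE hdeg hram) => //; exact: (integers1 hE).
move=> z Oz; have [->|z0] := eqVneq z 0; first by left.
right; rewrite leNgt; apply/negP => vz.
have Ozm m : O (z ^+ m).
  by elim: m => [|m IH]; rewrite ?expr0 ?exprS; [exact: order_one|exact: orderM].
have := hO _ (Ozm `|N|.+1); rewrite val_geP ?expf_neq0 // (valuationX hE) //.
nia.
Qed.

Lemma crd_swap y w z : cubic_basis 1 y w -> cubic_basis 1 w y ->
  crd1 1 w y z = crd2 1 y w z /\ crd2 1 w y z = crd1 1 y w z.
Proof.
move=> h h'; rewrite {1 3}[z](crdE h) addrAC.
by have [_ -> ->] := crd_comb h' (crd0 1 y w z) (crd2 1 y w z) (crd1 1 y w z).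
Qed.

(** Because 1 lies in [O] and coordinates along 1 are integral, they can be removed freely; what is
    left is a two by two Hermite form. The bound [m] on the w-coordinates, together with b <= m,
    makes the off-diagonal entry a multiple pi^b e with e divisible by pi^(m - b), so the first row
    is divisible by pi^b. *)
Lemma order_hermite O y w (b m k : nat) : cubic_basis 1 y w ->
  osubmodule vF O -> O 1 -> O `<=` ⟨1, y, w⟩ ->
  (exists2 g, O g & crd1 1 y w g = pi ^+ b) ->
  (forall z, O z -> val_ge vF b (crd1 1 y w z)) ->
  (forall z, O z -> val_ge vF m (crd2 1 y w z)) ->
  O (pi ^+ k *: w) -> (b <= m)%N ->
  exists a e, [/\ O = ⟨1, pi ^+ b *: (y + e *: w), pi ^+ a *: w⟩,
    val_ge vF (m - b)%N e & (m <= a)%N].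
Proof.
move=> hb sO O1 OM [g Og eg] hb1 hm Ow bm; have [O0 OD OZ] := sO.
have [l0 l1 l2] := crd_linear 1 y w.
have [[g00 g01 g02] [[g10 g11 g12] [g20 g21 g22]]] := crd_gens hb.
have OMP z : O z -> [/\ o (crd0 1 y w z), o (crd1 1 y w z) & o (crd2 1 y w z)].
  by move/OM/(span3_coordP hF hpi hb).
have [| | |a [Oa ha]] := @ideal_gen _ vF hF pi hpi [set c | O (c *: w)].
- by move=> c /OMP[_ _]; rewrite linformZ // g22 mulr1.
- by move=> c d oc Od; rewrite /= -scalerA; apply: OZ.
- by exists (pi ^+ k) => //; exact: (unifX_neq0 hpi).
have pb0 := unifX_neq0 hpi b.
pose e := crd2 1 y w g / pi ^+ b.
have ve : val_ge vF (m - b)%N e.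
  apply: (val_ge_div hF) => //; rewrite (val_unifX hF hpi).
  by apply: val_ge_le (hm _ Og); lia.
have Og' : O (pi ^+ b *: (y + e *: w)).
  have -> : pi ^+ b *: (y + e *: w) = g - crd0 1 y w g *: 1.
    rewrite [X in _ = X - _](crdE hb g) eg scalerDr scalerA /e mulrC divfK //.
    have addBB (A B C : E) : A + B + C - A = B + C by ring.
    by rewrite addBB.
  by apply: (osubmoduleB hF) => //; apply: OZ => //; case: (OMP g Og).
exists a, e; split=> //; last first.
  apply/(val_ge_unifXP hF hpi); have := hm _ Oa.
  by rewrite linformZ // g22 mulr1.
apply/seteqP; split; last exact: span3_sub.
move=> z Oz; have [q oq eq] := (val_ge_unifP hF hpi _ _).1 (hb1 z Oz).
have [oz0 _ _] := OMP z Oz.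
(* Removing the component along 1 and the multiple [q] of the first generator leaves a multiple of
   [w] in [O], hence an integral multiple of pi^a w. *)
pose c := crd2 1 y w z - q * pi ^+ b * e.
have ec : z - crd0 1 y w z *: 1 - q *: (pi ^+ b *: (y + e *: w)) = c *: w.
  rewrite {1}[z](crdE hb) eq !scalerDr !scalerA /c scalerBl.
  have addBB (A B C D : E) : A + B + C - A - (B + D) = C - D by ring.
  by rewrite [q * pi ^+ b]mulrC addBB.
have Oc : O (c *: w).
  rewrite -ec; apply: (osubmoduleB hF) => //; last exact: OZ.
  by apply: (osubmoduleB hF) => //; exact: OZ.
have [c' oc' ec'] := (val_ge_unifP hF hpi _ _).1 (ha _ Oc).
apply/span3P; exists (crd0 1 y w z), q, c'; split=> //.
rewrite [c' *: _]scalerA [c' * _]mulrC -ec' -ec.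
have addBB (A B C : E) : A = B + C + (A - B - C) by ring.
exact: addBB.
Qed.

(** The data on which the study of L(b, a) depends, with [eps] the valuation of the e2-coordinate of
    e1^2. *)
Definition integral_frame (e1 e2 : E) (eps : nat) : Prop := exists r t p : F,
  [/\ integers vE = ⟨1, e1, e2⟩, e1 ^+ 2 = r%:A + t *: e1 + p *: e2,
      o r, o t & p != 0 /\ vF p = eps].

Lemma val_ge_ideal N a b : o a -> val_ge vF N b -> val_ge vF N (a * b).
Proof. by move=> oa hb; rewrite -[N]add0r; apply: (val_geM hF). Qed.

Lemma scaleE a y : a *: y = in_alg E a * y.
Proof. by rewrite in_algE mulr_algl. Qed.

Lemma integral_frame1 e : o e -> integral_frame (x + e *: x ^+ 2) (x ^+ 2) 0.
Proof.
move=> oe; have [al [be [ga [ex3 val vbe ga0 vga]]]] := eisenstein hE hdeg hram hx.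
have wint c : val_ge vF 1 c -> o c by apply: val_ge_le.
have vgga : val_ge vF 1 ga by right; rewrite vga.
have D N := @val_geD _ vF hF N; have B N := @val_geB _ vF hF N.
(* In x^2 + 2e x^3 + e^2 x^4, reduced by the Eisenstein equation, [r] and [t] are the coefficients
   of 1 and x, and 1 + q + e t is that of x^2. The term e t moves when x is rewritten as e1 - e x^2.
   As pi divides [q], 1 + q is a unit. *)
pose t := e * (be + be) + e * (e * (al * be + ga)).
pose q := e * (al + al) + e * (e * (al * al + be)) - e * t.
pose r := e * (ga + ga) + e * (e * (al * ga)).
have vt : val_ge vF 1 t.
  apply: (D); do ?apply: val_ge_ideal => //; first exact: D.
  by apply: (D) => //; apply: val_ge_ideal => //; exact: wint.
have vq : val_ge vF 1 q.
  apply: B; last exact: val_ge_ideal.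
  apply: (D); do ?apply: val_ge_ideal => //; first exact: D.
  by apply: (D) => //; apply: val_ge_ideal => //; exact: wint.
have or : o r.
  apply: (wint); apply: (D); do ?apply: val_ge_ideal => //; first exact: D.
  exact: wint.
exists r, t, (1 + q); split=> //; last first.
- have [|h1 h2] := @valuation_addl _ vF hF 1 q (oner_neq0 F).
    by case: vq => [->|?]; [left|right; rewrite (valuation1 hF); lia].
  by split=> //; rewrite h2 (valuation1 hF).
- exact: wint.
- have -> : t *: (x + e *: x ^+ 2) = t *: x + (t * e) *: x ^+ 2.
    by rewrite scalerDr scalerA.
  rewrite /q; move: ex3; rewrite !scaleE !(rmorphB, rmorphD, rmorphM, rmorph1) /=.
  move=> ex3.
  ring: ex3.
- rewrite (integers_power_basis hF hE hdeg hram hpi hx).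
  have [g0 g1 g2] := span3_gens hF 1 x (x ^+ 2).
  have [h0 h1 h2] := span3_gens hF 1 (x + e *: x ^+ 2) (x ^+ 2).
  have sG := span3_submodule hF 1 x (x ^+ 2).
  have sH := span3_submodule hF 1 (x + e *: x ^+ 2) (x ^+ 2).
  apply/seteqP; split; apply: span3_sub => //.
    rewrite -[X in _ X](addrK (e *: x ^+ 2)).
    by apply: (osubmoduleB hF) => //; case: sH => _ _; apply.
  by case: (sG) => _ + GZ; apply=> //; exact: GZ.
Qed.

Lemma integral_frame2 e : val_ge vF 1 e -> integral_frame (e *: x + x ^+ 2) x 1.
Proof.
move=> ve; have [al [be [ga [ex3 val vbe ga0 vga]]]] := eisenstein hE hdeg hram hx.
have wint c : val_ge vF 1 c -> o c by apply: val_ge_le.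
have oe := wint _ ve; have oal := wint _ val.
have vgga : val_ge vF 1 ga by right; rewrite vga.
have D N := @val_geD _ vF hF N; have B N := @val_geB _ vF hF N.
have M2 c d : val_ge vF 1 c -> val_ge vF 1 d -> val_ge vF 2 (c * d).
  exact: (val_geM hF).
(* In e^2 x^2 + 2e x^3 + x^4, [r] and [t] are the coefficients of 1 and x^2, and the coefficient of
   x is ga + q + e t, the last term moving when x^2 is rewritten as e1 - e x. Since pi divides e, al
   and be, [q] has valuation at least 2, so ga + q is a uniformizer like ga. *)
pose t := al * al + be + (e + e) * al + e * e.
pose q := al * be + (e + e) * be - e * t.
pose r := al * ga + (e + e) * ga.
have vt : val_ge vF 1 t.
  apply: (D); last exact: val_ge_ideal.
  apply: (D); last by apply: val_ge_ideal => //; apply: wint; exact: D.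
  by apply: (D) => //; exact: val_ge_ideal.
have vq : val_ge vF 2 q.
  apply: B; last exact: M2.
  by apply: (D); [exact: M2|apply: M2 => //; exact: D].
have or : o r.
  apply: (wint); apply: (D); apply: val_ge_ideal => //; apply: wint; exact: D.
exists r, t, (ga + q); split=> //; last first.
- have [|h1 h2] := @valuation_addl _ vF hF ga q ga0.
    by case: vq => [->|?]; [left|right; lia].
  by split=> //; rewrite h2 vga.
- exact: wint.
- rewrite /q; move: ex3; rewrite !scaleE !(rmorphB, rmorphD, rmorphM, rmorph1) /=.
  by move=> ex3; ring: ex3.
- rewrite (integers_power_basis hF hE hdeg hram hpi hx).
  have [g0 g1 g2] := span3_gens hF 1 x (x ^+ 2).
  have [h0 h1 h2] := span3_gens hF 1 (e *: x + x ^+ 2) x.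
  have sG := span3_submodule hF 1 x (x ^+ 2).
  have sH := span3_submodule hF 1 (e *: x + x ^+ 2) x.
  apply/seteqP; split; apply: span3_sub => //.
    have ex2 : x ^+ 2 = (e *: x + x ^+ 2) - e *: x by rewrite addrAC subrr add0r.
    rewrite [X in _ X]ex2.
    by apply: (osubmoduleB hF) => //; case: sH => _ _; apply.
  by case: (sG) => _ + GZ; apply=> //; exact: GZ.
Qed.

Lemma span3_swap (e0 e1 e2 : E) : ⟨e0, e1, e2⟩ = ⟨e0, e2, e1⟩.
Proof.
have [g0 g1 g2] := span3_gens hF e0 e1 e2; have sG := span3_submodule hF e0 e1 e2.
have [h0 h1 h2] := span3_gens hF e0 e2 e1; have sH := span3_submodule hF e0 e2 e1.
by apply/seteqP; split; apply: span3_sub.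
Qed.

(** The two first generators differ by pi^b d e2, which must be a multiple of pi^a e2. With d the
    difference of two shears, this decides when two parameters c give the same order. *)
Lemma sheared_lattice_eq (e1 e2 : E) (d : F) b a : cubic_basis 1 e1 e2 ->
  ⟨1, pi ^+ b *: (e1 + d *: e2), pi ^+ a *: e2⟩ = ⟨1, pi ^+ b *: e1, pi ^+ a *: e2⟩
  <-> val_ge vF a (pi ^+ b * d).
Proof.
move=> hb; have [_ _ l2] := crd_linear 1 e1 e2.
have [_ [_ [_ g21 g22]]] := crd_gens hb.
have [g0 g1 g2] := span3_gens hF 1 (pi ^+ b *: (e1 + d *: e2)) (pi ^+ a *: e2).
have [h0 h1 h2] := span3_gens hF 1 (pi ^+ b *: e1) (pi ^+ a *: e2).
have sG := span3_submodule hF 1 (pi ^+ b *: (e1 + d *: e2)) (pi ^+ a *: e2).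
have sH := span3_submodule hF 1 (pi ^+ b *: e1) (pi ^+ a *: e2).
split=> [eL|/(val_ge_unifP hF hpi)[c oc ec]].
  move: g1; rewrite eL => /(span3_scaledP hF hpi hb)[_ _].
  by rewrite linformZ // linformD // linformZ // g21 g22 add0r mulr1.
have ed : pi ^+ b *: (e1 + d *: e2) = pi ^+ b *: e1 + c *: (pi ^+ a *: e2).
  by rewrite scalerDr !scalerA ec mulrC.
apply/seteqP; split; apply: span3_sub => //.
  by rewrite ed; case: (sH) => _ + HZ; apply=> //; exact: HZ.
have -> : pi ^+ b *: e1 = pi ^+ b *: (e1 + d *: e2) - c *: (pi ^+ a *: e2).
  by rewrite ed addrK.
by apply: (osubmoduleB hF) => //; case: sG => _ _; apply.
Qed.

Lemma principal_idealP k (c : F) :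
  principal_ideal vF (pi ^+ k) c <-> val_ge vF k c.
Proof.
split=> [[d od <-]|/(val_ge_unifP hF hpi)[d od ->]]; last by exists d.
by apply/(val_ge_unifP hF hpi); exists d.
Qed.

Lemma val_ge_unif_mul (N : int) (k : nat) (c : F) :
  val_ge vF (k%:Z + N) (pi ^+ k * c) <-> val_ge vF N c.
Proof.
have [->|c0] := eqVneq c 0; first by rewrite mulr0; split; left.
rewrite !val_geP ?mulf_neq0 ?(unifX_neq0 hpi) //.
by rewrite (valuation_mul hF) ?(unifX_neq0 hpi) // (val_unifX hF hpi); lia.
Qed.

Lemma basis_of_frame (e1 e2 : E) eps : integral_frame e1 e2 eps -> cubic_basis 1 e1 e2.
Proof.
by move=> [r [t [p [hO _ _ _ _]]]]; exact: (frame_basis hF hE hdeg hram hpi hx hO).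
Qed.

Lemma sheared1_unif e b a n : o e ->
  ⟨1, pi ^+ b *: (x + e *: x ^+ 2), pi ^+ a *: x ^+ 2⟩ (pi ^+ n *: x) <->
  (b <= n)%N /\ val_ge vF a (pi ^+ n * e).
Proof.
move=> oe; have hb := basis_of_frame (integral_frame1 oe).
have -> : pi ^+ n *: x = 0 *: 1 + pi ^+ n *: (x + e *: x ^+ 2)
    + (- (pi ^+ n * e)) *: x ^+ 2.
  by rewrite scale0r add0r scalerDr scalerA scaleNr addrK.
have [k0 k1 k2] := crd_comb hb 0 (pi ^+ n) (- (pi ^+ n * e)).
split=> [/(span3_scaledP hF hpi hb)|[bn ve]].
  rewrite k0 k1 k2 => -[_ /(val_ge_unifXP hF hpi) ? /(val_geN hF)].
  by rewrite opprK.
apply/(span3_scaledP hF hpi hb); rewrite k0 k1 k2; split; first by left.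
  exact/(val_ge_unifXP hF hpi).
exact: (val_geN hF).
Qed.

(** This gains one over the general bound 3a. The x^2-coordinate of z is only divisible by pi^(a-1),
    but b <= a - 1 suffices for it, and replacing x^2 by (e x + x^2) - e x creates a multiple of x
    divisible by pi^a because pi divides e. *)
Lemma lattice2_conductor e b a z : val_ge vF 1 e -> (b < a)%N ->
  val_ge vE (3 * a%:Z - 1) z ->
  ⟨1, pi ^+ b *: (e *: x + x ^+ 2), pi ^+ a *: x⟩ z.
Proof.
move=> ve ba; have pb := power_basis hE hdeg hram hx; rewrite [z](crdE pb).
have [g0 g1 g2] := span3_gens hF 1 (pi ^+ b *: (e *: x + x ^+ 2)) (pi ^+ a *: x).
have sG := span3_submodule hF 1 (pi ^+ b *: (e *: x + x ^+ 2)) (pi ^+ a *: x).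
have [_ GD GZ] := sG.
move/(val_ge_power_basis hE hdeg hram hx) => [h0 h1 h2].
have k0 := (val_ge_scaleXP hE hdeg hram hx _ _ 0).1 h0.
have k1 := (val_ge_scaleXP hE hdeg hram hx _ _ 1).1 h1.
have k2 := (val_ge_scaleXP hE hdeg hram hx _ _ 2).1 h2.
have v0 : o (crd0 1 x (x ^+ 2) z) by case: k0 => ?; [left|right; lia].
have v1 : val_ge vF a (crd1 1 x (x ^+ 2) z) by case: k1 => ?; [left|right; lia].
have v2 : val_ge vF a.-1 (crd2 1 x (x ^+ 2) z) by case: k2 => ?; [left|right; lia].
have Gx c : val_ge vF a c ->
    ⟨1, pi ^+ b *: (e *: x + x ^+ 2), pi ^+ a *: x⟩ (c *: x).
  by move=> /(val_ge_unifP hF hpi)[d od ->]; rewrite mulrC -scalerA; apply: GZ.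
apply: (GD); first by apply: (GD); [exact: GZ|exact: Gx].
move: v2; set c := crd2 _ _ _ z => v2.
have -> : c *: x ^+ 2 = c *: (e *: x + x ^+ 2) - (c * e) *: x.
  by rewrite scalerDr scalerA addrAC subrr add0r.
apply: (osubmoduleB hF) => //; last first.
  by apply: Gx; rewrite (_ : a%:Z = a.-1%:Z + 1); [exact: (val_geM hF)|lia].
have /(val_ge_unifP hF hpi)[d od ->] : val_ge vF b c by apply: val_ge_le v2; lia.
by rewrite mulrC -scalerA; apply: GZ.
Qed.

(** * The two families of orders *)

Section Families.
Variable n : nat.
Local Notation R := (adjoin_integers vF (pi ^+ n *: x)).
Local Notation O1 := (order1 vF pi x n).
Local Notation O2 := (order2 vF pi x).

Let shear1 f (c : F) := c * pi ^+ (f %/ 3 - minn n (f %/ 3)).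

Let frame1 f (c : F) : o c -> integral_frame (x + shear1 f c *: x ^+ 2) (x ^+ 2) 0.
Proof.
by move=> oc; apply: integral_frame1; apply: integersM => //; exact: (integers_unifX hF hpi).
Qed.

Let val_shear2 (c : F) : o c -> val_ge vF 1 (c * pi).
Proof.
by move=> oc; apply: val_ge_ideal => //; right; case: hpi => _ ->.
Qed.

Let frame2 (c : F) : o c -> integral_frame ((c * pi) *: x + x ^+ 2) x 1.
Proof. by move=> oc; apply: integral_frame2; exact: val_shear2. Qed.

Let order2E s f c : O2 s f c = ⟨1, pi ^+ (s - (f + 1) %/ 3) *: ((c * pi) *: x + x ^+ 2),
  pi ^+ ((f + 1) %/ 3) *: x⟩.
Proof. by rewrite /order2 span3_swap. Qed.

(** With a = f/3 and b = s - f/3, the conditions b <= a, a <= 2b and b <= n become 3s <= 2f, f <= 2s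
    and s <= f/3 + n. *)
Lemma order1_overorder s f (c : F) : o c ->
  (dom1 s f /\ overorder vF R (O1 s f c)) <->
  [/\ 3 %| f, 3 * s <= 2 * f, f <= 2 * s & s <= f %/ 3 + n]%N.
Proof.
move=> oc; have [r [t [p [hO esq or ot [p0 vp]]]]] := frame1 f oc.
have oS : o (shear1 f c) by apply: integersM => //; exact: (integers_unifX hF hpi).
have hord := lat_order hF hE hdeg hram hpi hx hO esq or ot p0 vp.
split=> [[/and3P[d1 d2 d3] [ord]]|[h1 h2 h3 h4]].
  rewrite (adjoin_integers_sub hF _ ord) => /(sheared1_unif _ _ _ oS)[bn _].
  by have := (hord _ _ d3).1 ord; split; lia.
have d : dom1 s f by apply/and3P; split=> //; lia.
have d3 : (s - f %/ 3 <= f %/ 3)%N by lia.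
have ord : is_order vF (O1 s f c) by apply/(hord _ _ d3); lia.
split=> //; split=> //; apply/(adjoin_integers_sub hF _ ord).
apply/(sheared1_unif _ _ _ oS); split; first by lia.
(* The second condition for pi^n x holds for every integral c, since n + (a - min(n, a)) >= a. *)
rewrite mulrCA -exprD; apply: val_ge_ideal => //.
by apply: (val_ge_unifX hF hpi); lia.
Qed.

(** With a = (f + 1)/3 and b = s - a, the conditions are b < a, a <= 2b + 1 and a <= n. The first
    gives 3s < 2f + 2, and as 3 divides 2f + 2 this sharpens to 3s + 1 <= 2f. *)
Lemma order2_overorder s f (c : F) : o c ->
  (dom2 s f /\ overorder vF R (O2 s f c)) <->
  [/\ 3 %| f + 1, 3 * s + 1 <= 2 * f, f <= 2 * s & f + 1 <= 3 * n]%N.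
Proof.
move=> oc; have [r [t [p [hO esq or ot [p0 vp]]]]] := frame2 oc.
have hb := basis_of_frame (frame2 oc).
have hord := lat_order hF hE hdeg hram hpi hx hO esq or ot p0 vp.
rewrite order2E.
split=> [[/and3P[d1 d2 d3] [ord]]|[h1 h2 h3 h4]].
  rewrite (adjoin_integers_sub hF _ ord) => /(scaled_gen2 hF hpi hb) bn.
  by have := (hord _ _ (ltnW d3)).1 ord; split; lia.
have d : dom2 s f by apply/and3P; split=> //; lia.
have d3 : (s - (f + 1) %/ 3 <= (f + 1) %/ 3)%N by lia.
have ord := (hord _ _ d3).2.
split=> //; split; first by apply: ord; lia.
apply/(adjoin_integers_sub hF); first by apply: ord; lia.
by apply/(scaled_gen2 hF hpi hb); lia.
Qed.

Lemma order1_invariants s f (c : F) : o c -> dom1 s f ->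
  order_length vF vE (O1 s f c) s /\ conductor_exponent vE x (O1 s f c) f.
Proof.
move=> oc /and3P[d1 d2 d3]; have [r [t [p [hO esq or ot [p0 vp]]]]] := frame1 f oc.
have hb := basis_of_frame (frame1 f oc); split.
  have := lat_length hF hE hdeg hram hpi hx hO (s - f %/ 3) (f %/ 3).
  by rewrite subnKC.
have f3 : (3 * (f %/ 3))%N = f by lia.
apply: (conductor_exponentP hE hx) => [z|].
  rewrite -{1}f3 PoszM => hz.
  exact: (lat_conductor hF hE hdeg hram hpi hx hO d3).
have [->|f0] := eqVneq f 0%N; [by left|right].
have nL := @lat_not_conductor _ _ _ _ hF hE hdeg hram _ _ hpi hx _ _ hO
  (s - f %/ 3) (f %/ 3).
(* Its valuation is 3 (f/3 - 1) + 2 = f - 1. *)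
exists (pi ^+ (f %/ 3).-1 *: x ^+ 2); last by apply: nL; lia.
by apply/(val_ge_scaleXP hE hdeg hram hx); right; rewrite (val_unifX hF hpi); lia.
Qed.

Lemma order2_invariants s f (c : F) : o c -> dom2 s f ->
  order_length vF vE (O2 s f c) s /\ conductor_exponent vE x (O2 s f c) f.
Proof.
move=> oc /and3P[d1 d2 d3]; have [r [t [p [hO esq or ot [p0 vp]]]]] := frame2 oc.
rewrite order2E; split.
  have := lat_length hF hE hdeg hram hpi hx hO (s - (f + 1) %/ 3) ((f + 1) %/ 3).
  by rewrite subnKC.
apply: (conductor_exponentP hE hx) => [z hz|].
  apply: lattice2_conductor => //; first exact: val_shear2.
  by apply: val_ge_le hz; lia.
right.
have nL := @lat_not_conductor _ _ _ _ hF hE hdeg hram _ _ hpi hx _ _ hO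
  (s - (f + 1) %/ 3) ((f + 1) %/ 3).
(* Its valuation is 3 ((f + 1)/3 - 1) + 1 = f - 1. *)
exists (pi ^+ ((f + 1) %/ 3).-1 *: x); last by apply: nL; lia.
rewrite -[X in _ *: X]expr1; apply/(val_ge_scaleXP hE hdeg hram hx).
by right; rewrite (val_unifX hF hpi); lia.
Qed.

Lemma order_invariants_inj O s f s' f' :
  order_length vF vE O s /\ conductor_exponent vE x O f ->
  order_length vF vE O s' /\ conductor_exponent vE x O f' -> (s, f) = (s', f').
Proof.
move=> [hs hf] [hs' hf']; rewrite (quotient_length_inj hs hs').
by rewrite (conductor_exponent_inj hE hx hf hf').
Qed.

(** Length and conductor recover (s, f); for equal (s, f) the criterion is b + (a - min(n, a)) + v(c
    - c') >= a, unless c = c'. The bound s <= f/3 + n, that is b <= n, makes the subtraction min(n,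
    a) - b exact. *)
Lemma order1_eq s f c s' f' c' : o c -> o c' -> dom1 s f -> dom1 s' f' ->
  (s <= f %/ 3 + n)%N ->
  O1 s f c = O1 s' f' c' <-> (s, f) = (s', f') /\
    principal_ideal vF (pi ^+ (minn n (f %/ 3) - (s - f %/ 3))) (c - c').
Proof.
move=> oc oc' d d' sn.
have key : O1 s f c = O1 s f c' <->
    principal_ideal vF (pi ^+ (minn n (f %/ 3) - (s - f %/ 3))) (c - c').
  have hb := basis_of_frame (frame1 f oc').
  have e : x + shear1 f c *: x ^+ 2
      = x + shear1 f c' *: x ^+ 2 + (shear1 f c - shear1 f c') *: x ^+ 2.
    by rewrite -addrA -scalerDl [shear1 f c' + _]addrC subrK.
  rewrite /order1 -/(shear1 f c) -/(shear1 f c') e (sheared_lattice_eq _ _ _ hb).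
  rewrite principal_idealP /shear1 -mulrBl [(c - c') * _]mulrC mulrA -exprD.
  rewrite -[X in _ <-> X](val_ge_unif_mul _ (s - f %/ 3 + (f %/ 3 - minn n (f %/ 3)))).
  have <- : (f %/ 3)%:Z = (s - f %/ 3 + (f %/ 3 - minn n (f %/ 3)))%N%:Z
      + (minn n (f %/ 3) - (s - f %/ 3))%N%:Z.
    by case/and3P: d; lia.
  by [].
split=> [h|[[es ef] h]]; last by subst s' f'; apply/key.
have := order_invariants_inj (order1_invariants oc d).
rewrite {1 2}h => /(_ _ _ (order1_invariants oc' d')) [es ef].
by subst s' f'; split=> //; apply/key.
Qed.

(** Here the shears differ by (c - c') pi, so the exponent is a - b - 1, which is 2 (f + 1)/3 - s -
    1. *)
Lemma order2_eq s f c s' f' c' : o c -> o c' -> dom2 s f -> dom2 s' f' ->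
  O2 s f c = O2 s' f' c' <-> (s, f) = (s', f') /\
    principal_ideal vF (pi ^+ (2 * (f + 1) %/ 3 - s - 1)) (c - c').
Proof.
move=> oc oc' d d'.
have key : O2 s f c = O2 s f c' <->
    principal_ideal vF (pi ^+ (2 * (f + 1) %/ 3 - s - 1)) (c - c').
  have hb := basis_of_frame (frame2 oc').
  have e : (c * pi) *: x + x ^+ 2
      = (c' * pi) *: x + x ^+ 2 + (c * pi - c' * pi) *: x.
    by rewrite addrAC -scalerDl [c' * pi + _]addrC subrK.
  rewrite !order2E e (sheared_lattice_eq _ _ _ hb).
  rewrite principal_idealP -mulrBl [(c - c') * _]mulrC mulrA -exprSr.
  rewrite -[X in _ <-> X](val_ge_unif_mul _ (s - (f + 1) %/ 3).+1).
  have <- : ((f + 1) %/ 3)%:Z = (s - (f + 1) %/ 3).+1%:Z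
      + (2 * (f + 1) %/ 3 - s - 1)%N%:Z.
    by case/and3P: d; lia.
  by [].
split=> [h|[[es ef] h]]; last by subst s' f'; apply/key.
have := order_invariants_inj (order2_invariants oc d).
rewrite {1 2}h => /(_ _ _ (order2_invariants oc' d')) [es ef].
by subst s' f'; split=> //; apply/key.
Qed.

(** The conductor exponents are 0 modulo 3 in the first family and 2 modulo 3 in the second. *)
Lemma order1_neq_order2 s f c s' f' c' : o c -> o c' -> dom1 s f -> dom2 s' f' ->
  O1 s f c <> O2 s' f' c'.
Proof.
move=> oc oc' d d' e; have := order_invariants_inj (order1_invariants oc d).
rewrite {1 2}e => /(_ _ _ (order2_invariants oc' d')) [_ ef].
by case/and3P: d d'; rewrite ef => ? _ _ /and3P[]; lia.
Qed.

Lemma order1_gorenstein s f (c : F) : o c -> dom1 s f -> (f <= 2 * s)%N ->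
  gorenstein (O1 s f c) <-> f = (2 * s)%N.
Proof.
move=> oc /and3P[d1 d2 d3] fs.
have [r [t [p [hO esq or ot [p0 vp]]]]] := frame1 f oc.
rewrite (lat_gorenstein hF hE hdeg hram hpi hx hO esq or ot p0 vp); last 2 first.
- by rewrite addn0.
- lia.
split; lia.
Qed.

(** The criterion a = 2b + 1 with 3a = f + 1 and b = s - a reads f = 2s, as a = 2b does in the first
    family. *)
Lemma order2_gorenstein s f (c : F) : o c -> dom2 s f -> (f <= 2 * s)%N ->
  gorenstein (O2 s f c) <-> f = (2 * s)%N.
Proof.
move=> oc /and3P[d1 d2 d3] fs.
have [r [t [p [hO esq or ot [p0 vp]]]]] := frame2 oc.
rewrite order2E (lat_gorenstein hF hE hdeg hram hpi hx hO esq or ot p0 vp); last 2 first.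
- lia.
- lia.
split; lia.
Qed.

Lemma overorder_classification O : overorder vF R O ->
  (exists s f c, [/\ o c, dom1 s f & O = O1 s f c]) \/
  (exists s f c, [/\ o c, dom2 s f & O = O2 s f c]).
Proof.
move=> [oO RO]; have sO := order_submodule oO; have Oone := order_one oO.
have OE := order_sub_integers oO.
have pb := power_basis hE hdeg hram hx.
have eE := integers_power_basis hF hE hdeg hram hpi hx.
have pb' : cubic_basis 1 (x ^+ 2) x.
  apply: (full_basis hdeg (vF := vF)); rewrite span3_swap -eE.
  exact: (integers_full hF hE hdeg hram hpi hx).
have Ox : O (pi ^+ n *: x) by apply/(adjoin_integers_sub hF _ oO).
have Ox2 : O (pi ^+ (n + n) *: x ^+ 2).
  by rewrite exprD -scalerA expr2 scalerAr scalerAl; apply: orderM.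
have [l0 l1 l2] := crd_linear 1 x (x ^+ 2).
have [_ [[_ g11 _] [_ _ g22]]] := crd_gens pb.
have OP z : O z -> [/\ o (crd0 1 x (x ^+ 2) z), o (crd1 1 x (x ^+ 2) z)
    & o (crd2 1 x (x ^+ 2) z)].
  by move/OE; rewrite eE => /(span3_coordP hF hpi pb).
have [_ _ OZ] := sO.
have [| | |b1 [[z1 Oz1 ez1] hb1]] :=
  @ideal_gen _ vF hF pi hpi [set crd1 1 x (x ^+ 2) z | z in O].
- by move=> _ [z /OP[? ? ?] <-].
- by move=> a _ oa [z Oz <-]; exists (a *: z); [exact: OZ|rewrite linformZ].
- exists (pi ^+ n); last exact: (unifX_neq0 hpi).
  by exists (pi ^+ n *: x); rewrite // linformZ // g11 mulr1.
have [| | |b2 [[z2 Oz2 ez2] hb2]] :=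
  @ideal_gen _ vF hF pi hpi [set crd2 1 x (x ^+ 2) z | z in O].
- by move=> _ [z /OP[? ? ?] <-].
- by move=> a _ oa [z Oz <-]; exists (a *: z); [exact: OZ|rewrite linformZ].
- exists (pi ^+ (n + n)); last exact: (unifX_neq0 hpi).
  by exists (pi ^+ (n + n) *: x ^+ 2); rewrite // linformZ // g22 mulr1.
have {}hb1 z : O z -> val_ge vF b1 (crd1 1 x (x ^+ 2) z).
  by move=> Oz; apply: hb1; exists z.
have {}hb2 z : O z -> val_ge vF b2 (crd2 1 x (x ^+ 2) z).
  by move=> Oz; apply: hb2; exists z.
have [b12|b21] := leqP b1 b2; [left|right].
  have [|a [e [eO ve ba]]] :=
      order_hermite pb sO Oone _ (ex_intro2 _ _ z1 Oz1 ez1) hb1 hb2 Ox2 b12.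
    by rewrite -eE.
  have oe : o e by apply: val_ge_le ve; lia.
  move: Ox; rewrite eO => /(sheared1_unif _ _ _ oe)[bn van].
  (* For n < a this is the divisibility of pi^n e by pi^a forced by R; for n >= a it is integrality
     of e. *)
  have : val_ge vF (a - minn n a)%N e.
    have [na|an] := leqP n a; last by rewrite (_ : (a - a)%N = 0%N) //; lia.
    by apply/(val_ge_unif_mul _ n); rewrite (_ : n%:Z + _ = a) //; lia.
  move=> /(val_ge_unifP hF hpi)[c oc ec].
  have e3 : (3 * a %/ 3)%N = a by rewrite mulKn.
  (* Here f/3 = a and s - f/3 = b1, and admissibility is b1 <= b2 <= a. *)
  exists (a + b1)%N, (3 * a)%N, c; split=> //.
    by rewrite /dom1 e3 dvdn_mulr // addKn leq_addr; lia.
  by rewrite /order1 e3 addKn mulrC -ec.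
have hb1' z : O z -> val_ge vF b1 (crd2 1 (x ^+ 2) x z).
  by move=> Oz; have [_ ->] := crd_swap z pb pb'; exact: hb1.
have hb2' z : O z -> val_ge vF b2 (crd1 1 (x ^+ 2) x z).
  by move=> Oz; have [-> _] := crd_swap z pb pb'; exact: hb2.
have ez2' : crd1 1 (x ^+ 2) x z2 = pi ^+ b2 by have [-> _] := crd_swap z2 pb pb'.
have [|a [e [eO ve ba]]] :=
  order_hermite pb' sO Oone _ (ex_intro2 _ _ z2 Oz2 ez2') hb2' hb1' Ox (ltnW b21).
  by rewrite span3_swap -eE.
(* Strictness of b2 < b1 makes e divisible by pi, which gives the factor c pi of the second
   family. *)
have [c oc ec] : exists2 c, o c & e = pi * c.
  have /(val_ge_unifP hF hpi) : val_ge vF 1%N e by apply: val_ge_le ve; lia.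
  by rewrite expr1.
have e3 : (((3 * a).-1 + 1) %/ 3 = a)%N by lia.
(* The predecessor is exact because a >= b1 > b2 >= 0, so f + 1 = 3a. *)
exists (a + b2)%N, (3 * a).-1, c; split=> //.
  by rewrite /dom2 e3; lia.
by rewrite order2E e3 addKn [c * pi]mulrC -ec addrC.
Qed.

End Families.

End Classification.
Theorem corollary4p11
    (F : fieldType) (vF : F -> int) (hF : nonarch_local_field vF)
    (E : fieldExtType F) (vE : E -> int) (hE : nonarch_local_field vE)
    (hdeg : \dim {:E} = 3%N) (hram : totally_ramified vF vE)
    (pi : F) (hpi : uniformizer vF pi) (x : E) (hx : uniformizer vE x)
    (n : nat) :
  let R := adjoin_integers vF (pi ^+ n *: x) in
  let O1 := order1 vF pi x n in
  let O2 := order2 vF pi x in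
  (* (s, f, c) are admissible parameters whose order is an overorder of R *)
  let over1 s f c :=
    [/\ integers vF c, dom1 s f & overorder vF R (O1 s f c)] in
  let over2 s f c :=
    [/\ integers vF c, dom2 s f & overorder vF R (O2 s f c)] in
  (forall s f c, integers vF c ->
     (dom1 s f /\ overorder vF R (O1 s f c)) <->
     [/\ 3 %| f, 3 * s <= 2 * f, f <= 2 * s & s <= f %/ 3 + n]%N) /\
  (forall s f c, integers vF c ->
     (dom2 s f /\ overorder vF R (O2 s f c)) <->
     [/\ 3 %| f + 1, 3 * s + 1 <= 2 * f, f <= 2 * s & f + 1 <= 3 * n]%N) /\
  (* (1) *)
  (forall s f c, over1 s f c ->
     order_length vF vE (O1 s f c) s /\
     conductor_exponent vE x (O1 s f c) f) /\
  (forall s f c, over2 s f c ->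
     order_length vF vE (O2 s f c) s /\
     conductor_exponent vE x (O2 s f c) f) /\
  (* (2) *)
  (forall s f c s' f' c', over1 s f c -> over1 s' f' c' ->
     O1 s f c = O1 s' f' c' <->
     (s, f) = (s', f') /\
     principal_ideal vF (pi ^+ (minn n (f %/ 3) - (s - f %/ 3))) (c - c')) /\
  (forall s f c s' f' c', over2 s f c -> over2 s' f' c' ->
     O2 s f c = O2 s' f' c' <->
     (s, f) = (s', f') /\
     principal_ideal vF (pi ^+ (2 * (f + 1) %/ 3 - s - 1)) (c - c')) /\
  (* (3) *)
  (forall s f c s' f' c', over1 s f c -> over2 s' f' c' ->
     O1 s f c <> O2 s' f' c') /\
  (* (4) *)
  (forall s f c, over1 s f c -> (gorenstein (O1 s f c) <-> f = (2 * s)%N)) /\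
  (forall s f c, over2 s f c -> (gorenstein (O2 s f c) <-> f = (2 * s)%N)) /\
  (* every overorder of R is one of these *)
  (forall O : set E, overorder vF R O ->
     (exists s f c, over1 s f c /\ O = O1 s f c) \/
     (exists s f c, over2 s f c /\ O = O2 s f c)).
Proof.
have [hvF _ _] := hF; have [hvE _ _] := hE.
move=> R O1 O2 over1 over2.
have over1P s f c : over1 s f c ->
    [/\ integers vF c, dom1 s f, (f <= 2 * s)%N & (s <= f %/ 3 + n)%N].
  move=> [oc d ov].
  by have [_ _ ? ?] := (order1_overorder hvF hvE hdeg hram hpi hx n s f oc).1 (conj d ov).
have over2P s f c : over2 s f c ->
    [/\ integers vF c, dom2 s f & (f <= 2 * s)%N].
  move=> [oc d ov].
  by have [_ _ ? ?] := (order2_overorder hvF hvE hdeg hram hpi hx n s f oc).1 (conj d ov).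
split; [|split; [|split; [|split; [|split; [|split; [|split; [|split; [|split]]]]]]]].
- by move=> s f c; exact: (order1_overorder hvF hvE hdeg hram hpi hx).
- by move=> s f c; exact: (order2_overorder hvF hvE hdeg hram hpi hx).
- by move=> s f c /over1P[oc d _ _]; exact: (order1_invariants hvF hvE hdeg hram hpi hx).
- by move=> s f c /over2P[oc d _]; exact: (order2_invariants hvF hvE hdeg hram hpi hx).
- move=> s f c s' f' c' /over1P[oc d _ sn] /over1P[oc' d' _ _].
  exact: (order1_eq hvF hvE hdeg hram hpi hx).
- move=> s f c s' f' c' /over2P[oc d _] /over2P[oc' d' _].
  exact: (order2_eq hvF hvE hdeg hram hpi hx).
- move=> s f c s' f' c' /over1P[oc d _ _] /over2P[oc' d' _].
  exact: (order1_neq_order2 hvF hvE hdeg hram hpi hx).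
- move=> s f c /over1P[oc d fs _].
  exact: (order1_gorenstein hvF hvE hdeg hram hpi hx).
- move=> s f c /over2P[oc d fs].
  exact: (order2_gorenstein hvF hvE hdeg hram hpi hx).
move=> O ovO.
have [[s [f [c [oc d e]]]]|[s [f [c [oc d e]]]]] :=
    overorder_classification hvF hvE hdeg hram hpi hx ovO.
  by left; exists s, f, c; rewrite /over1 /O1 -e.
by right; exists s, f, c; rewrite /over2 /O2 -e.
Qed.
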